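(* A generic homeomorphism of the Cantor fan $C$ has no Li--Yorke pairs; that is, the set of all $\phi\in\mathrm{Homeo}(C)$ that have no Li--Yorke pairs is comeager in $\mathrm{Homeo}(C)$. In particular, zero topological entropy is generic for homeomorphisms of $C$, i.e., the set of all $\phi\in\mathrm{Homeo}(C)$ with topological entropy $0$ is comeager in $\mathrm{Homeo}(C)$.
   Context: The Cantor fan is $C=(2^{\mathbb N}\times[0,1])/\!\sim$, where $2^{\mathbb N}$ is the Cantor space and $(x,t)\sim(y,s)$ iff the pairs are equal or $s=t=0$. Fix a compatible metric $d$ on $C$; $\mathrm{Homeo}(C)$ is the Polish group of homeomorphisms of $C$ with the supremum metric. A Li--Yorke pair for $\phi$ is a pair $(x,y)\in C\times C$ with $\liminf_{n\to\infty} d(\phi^n(x),\phi^n(y))=0$ and $\limsup_{n\to\infty} d(\phi^n(x),\phi^n(y))>0$. *)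

(* Defs.v *)
From HB Require Import structures.
From mathcomp Require Import all_boot all_order all_algebra finmap.
From mathcomp Require Import all_classical all_reals all_analysis.

Set Implicit Arguments.
Unset Strict Implicit.
Unset Printing Implicit Defensive.

Import Order.TTheory GRing.Theory Num.Theory.
Import numFieldNormedType.Exports.

Local Open Scope classical_set_scope.
Local Open Scope ring_scope.

Notation unit_interval R := (set_type `[0 : R, 1]).

Definition fan_rel (R : realType) : rel (cantor_space * unit_interval R) :=
  fun p q => (p == q) || ((val p.2 == 0) && (val q.2 == 0)).

Lemma fan_rel_refl (R : realType) : reflexive (@fan_rel R).
Proof. by move=> p; rewrite /fan_rel eqxx. Qed.

Lemma fan_rel_sym (R : realType) : symmetric (@fan_rel R).
Proof. by move=> p q; rewrite /fan_rel eq_sym andbC. Qed.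

Lemma fan_rel_trans (R : realType) : transitive (@fan_rel R).
Proof.
move=> q p r; rewrite /fan_rel => /orP[/eqP->//|/andP[p0 q0]].
by move=> /orP[/eqP<-|/andP[_ r0]]; rewrite p0 ?q0 ?r0 orbT.
Qed.

Definition fan_equiv (R : realType) :=
  EquivRel (@fan_rel R) (@fan_rel_refl R) (@fan_rel_sym R) (@fan_rel_trans R).

Definition cantor_fan (R : realType) : Type := {eq_quot fan_equiv R}%qT.
HB.instance Definition _ (R : realType) :=
  Topological.copy (cantor_fan R) (quotient_topology {eq_quot fan_equiv R}%qT).
HB.instance Definition _ (R : realType) := Quotient.on (cantor_fan R).

Lemma unit_interval_compact (R : realType) : compact [set: unit_interval R].
Proof.
have clampP (x : R) : Num.max 0 (Num.min x 1) \in `[0 : R, 1]%classic.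
  by rewrite inE /= in_itv /= le_max lexx /= ge_max ler01 ge_min lexx orbT.
pose clamp (x : R) : unit_interval R := SigSub (clampP x).
have ctsclamp : continuous clamp.
  apply: (@continuous_comp_initial (unit_interval R) R R set_val clamp).
  have -> : set_val \o clamp = fun x : R => Num.max 0 (Num.min x 1).
    by apply/funext => x /=; rewrite set_valE.
  move=> x; apply: (@continuous_max R R (cst 0) (id \min cst 1)).
    exact: cvg_cst.
  by apply: (@continuous_min R R id (cst 1)); [exact: cvg_id | exact: cvg_cst].
have -> : [set: unit_interval R] = clamp @` `[0 : R, 1].
  apply/seteqP; split => // t _.
  have := set_mem (valP t); rewrite /= in_itv /= => /andP[t0 t1].
  exists (val t); first by rewrite /= in_itv /= t0 t1.
  by apply/val_inj => /=; rewrite (min_idPl t1) (max_idPr t0).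
apply: continuous_compact; last exact: segment_compact.
exact: continuous_subspaceT.
Qed.

Lemma cantor_fan_compact (R : realType) : compact [set: cantor_fan R].
Proof.
pose p : cantor_space * unit_interval R -> cantor_fan R := \pi_(cantor_fan R)%qT.
have -> : [set: cantor_fan R] = p @` ([set: cantor_space] `*` setT).
  by apply/seteqP; split => // x _; exists (repr x) => //; exact: reprK.
apply: continuous_compact; last first.
  exact: compact_setX cantor_space_compact (unit_interval_compact (R:=R)).
by apply: continuous_subspaceT; exact: pi_continuous.
Qed.

Record compatible_metric (R : realType) (T : topologicalType)
    (d : T -> T -> R) : Prop := CompatibleMetric {
  cmetric_xx : forall x, d x x = 0 ;
  cmetric_eq0 : forall x y, d x y = 0 -> x = y ;
  cmetric_sym : forall x y, d x y = d y x ;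
  cmetric_triangle : forall y x z, d x z <= d x y + d y z ;
  cmetric_nbhs : forall x,
    nbhs x = filter_from [set e : R | 0 < e] (fun e => [set y | d x y < e])
}.

Lemma cmetric_ge0 (R : realType) (T : topologicalType) (d : T -> T -> R) :
  compatible_metric d -> forall x y, 0 <= d x y.
Proof.
move=> dT x y; rewrite -(@pmulrn_lge0 _ _ 2)// -(cmetric_xx dT x).
by rewrite mulr2n {2}(cmetric_sym dT x y) (cmetric_triangle dT).
Qed.

Lemma cmetric_bounded (R : realType) (T : topologicalType) (d : T -> T -> R) :
  compact [set: T] -> compatible_metric d -> exists M, forall x y, d x y <= M.
Proof.
move=> /compact_near_coveringP cT dT.
have [[x0 _]|T0] := pselect ([set: T] !=set0); last first.
  by exists 0 => x; exfalso; apply: T0; exists x.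
have : \forall M \near +oo, [set: T] `<=` [set x | d x0 x < M].
  apply: cT => x _; exists ([set y | d x y < 1], [set M | d x0 x + 1 < M]).
    split => /=; last by exists (d x0 x + 1); split=> //; exact: num_real.
    by rewrite (cmetric_nbhs dT); exists 1 => //=.
  move=> [y M] /= [xy]; apply: le_lt_trans.
  by rewrite (le_trans (cmetric_triangle dT x _ _))// lerD2l ltW.
move=> /(@filter_ex _ _ _)[M MT]; exists (M + M) => x y.
rewrite (le_trans (cmetric_triangle dT x0 _ _))// (cmetric_sym dT x).
by rewrite lerD// ltW//; exact: MT.
Qed.

Definition homeomorphism (T : topologicalType) (f : T -> T) :=
  continuous f /\
  exists g : T -> T, [/\ continuous g, cancel f g & cancel g f].

Record homeo (T : topologicalType) := Homeo {
  homeo_fun :> T -> T ;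
  homeoP : homeomorphism homeo_fun
}.

(* [homeo T] with the metric [sup_dist d]; compactness of [T] ensures that the
   supremum is taken over a bounded set. *)
Definition homeo_space (R : realType) (T : topologicalType) (d : T -> T -> R)
  (cT : compact [set: T]) (dT : compatible_metric d) : Type := homeo T.

Definition sup_dist (R : realType) (T : topologicalType) (d : T -> T -> R)
    (f g : T -> T) : R :=
  sup (range (fun x => d (f x) (g x))).

Section homeo_metric.
Context (R : realType) (T : topologicalType) (d : T -> T -> R).
Context (cT : compact [set: T]) (dT : compatible_metric d).
Local Notation H := (homeo_space cT dT).

Let sup_dist_ub (f g : T -> T) x : d (f x) (g x) <= sup_dist d f g.
Proof.
apply: ub_le_sup; last by exists x.
by have [M dM] := cmetric_bounded cT dT; exists M => _ [y _ <-].
Qed.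

Let sup_dist_empty (f g : T -> T) :
  ~ ([set: T] !=set0) -> sup_dist d f g = 0.
Proof.
move=> T0; rewrite /sup_dist (_ : [set _ | _ in _] = set0) ?sup0//.
by rewrite -subset0 => y [x _ _]; apply: T0; exists x.
Qed.

Let sup_dist_le (f g : T -> T) M : 0 <= M ->
  (forall x, d (f x) (g x) <= M) -> sup_dist d f g <= M.
Proof.
move=> M0 fgM; have [[x0 _]|T0] := pselect ([set: T] !=set0).
  by apply: ge_sup; [exists (d (f x0) (g x0)), x0 | move=> _ [x _ <-]].
by rewrite sup_dist_empty.
Qed.

Let sup_dist_ge0 (f g : T -> T) : 0 <= sup_dist d f g.
Proof.
have [[x0 _]|T0] := pselect ([set: T] !=set0).
  exact: le_trans (cmetric_ge0 dT _ _) (sup_dist_ub f g x0).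
by rewrite sup_dist_empty.
Qed.

Let homeo_dist (f g : H) := sup_dist d f g.

Let homeo_distxx f : homeo_dist f f = 0.
Proof.
apply/le_anti; rewrite sup_dist_ge0 andbT.
by apply: sup_dist_le => // x; rewrite cmetric_xx.
Qed.

Let homeo_dist_positivity f g : homeo_dist f g = 0 -> f = g.
Proof.
case: f g => [f fP] [g gP] fg0.
suff fg : f = g by subst g; rewrite (Prop_irrelevance fP gP).
apply/funext => x; apply: (cmetric_eq0 dT).
apply/le_anti; rewrite cmetric_ge0// andbT.
by have := sup_dist_ub f g x; rewrite [sup_dist _ _ _]fg0.
Qed.

Let homeo_dist_sym f g : homeo_dist f g = homeo_dist g f.
Proof.
rewrite /homeo_dist /sup_dist; congr sup.
by apply: eq_imagel => x _; exact: cmetric_sym dT _ _.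
Qed.

Let homeo_dist_triangle g f h :
  homeo_dist f h <= homeo_dist f g + homeo_dist g h.
Proof.
apply: sup_dist_le => [|x]; first exact: addr_ge0 (sup_dist_ge0 _ _) (sup_dist_ge0 _ _).
apply: le_trans (cmetric_triangle dT (g x) _ _) _.
exact: lerD (sup_dist_ub _ _ x) (sup_dist_ub _ _ x).
Qed.

HB.instance Definition _ := gen_eqMixin H.
HB.instance Definition _ := gen_choiceMixin H.
HB.instance Definition _ := @isMetric.Build R H homeo_dist
  homeo_distxx homeo_dist_positivity homeo_dist_sym homeo_dist_triangle.

End homeo_metric.

Definition nowhere_dense (T : topologicalType) (A : set T) :=
  interior (closure A) = set0.

Definition meager (T : topologicalType) (A : set T) :=
  exists2 F : (set T)^nat,
    (forall i, nowhere_dense (F i)) & A = \bigcup_i F i.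

Definition comeager (T : topologicalType) (A : set T) := meager (~` A).

Section dynamics.
Context (R : realType) (T : topologicalType) (d : T -> T -> R).
Implicit Types (f : T -> T) (x y : T) (n : nat) (e : R).

Definition li_yorke_pair f x y :=
  let u : R^nat := fun n => d (iter n f x) (iter n f y) in
  limn_inf u = 0 /\ 0 < limn_sup u.

Definition bowen_dist f n x y : R :=
  \big[Num.max/0]_(i < n) d (iter i f x) (iter i f y).

Definition separated f n e (A : {fset T}) :=
  forall x y, x \in A -> y \in A -> x != y -> e < bowen_dist f n x y.

Definition max_separated f n e : \bar R :=
  ereal_sup [set (#|` A|%:R)%:E | A in separated f n e].

(* Bowen's definition of topological entropy: exponential growth rate of the
   maximal cardinality of (n, e)-separated sets, in the limit e -> 0+ *)
Definition entropy_at_scale f e : \bar R :=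
  limn_esup (fun n => (n%:R^-1)%:E * lne (max_separated f n e))%E.

Definition topological_entropy f : \bar R :=
  lim (entropy_at_scale f e @[e --> 0^'+]).

End dynamics.

(* Main.v *)
Require Import Defs.
From mathcomp Require Import all_boot all_order all_algebra finmap.
From mathcomp Require Import all_classical all_reals all_analysis.
From mathcomp Require Import zify ring lra.

(* For every scale [e] we exhibit an open dense set of homeomorphisms [f] admitting
   a finite coding: the fan is cut into finitely many cells of diameter at most [e],
   with a graph of possible transitions (robust under small errors) in which every
   vertex has at most one successor from which one can walk back to it, distinct
   recurrent cells being a positive distance apart.  Along an orbit the
   number of vertices reachable from the current cell can drop only finitely often,
   so every orbit is eventually periodic at the level of cells: two orbits end up
   [e]-close forever or stay apart, whence no Li-Yorke pairs; and the number of
   itineraries of length [n] is polynomial in [n], whence zero entropy.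

   Density.  A homeomorphism [f] of the fan fixes the apex and permutes the blades.
   Compose [f] with a map close to the identity that acts on each coordinate by a
   strong contraction: each cylinder of the Cantor set is pushed, off a tiny
   repelling cylinder, into a tiny attracting one, and the height is pushed, off tiny
   windows, towards finitely many levels (height 0, the apex, among them).  In
   general position [f] maps no attracting centre to a repelling one; then attracting
   coordinates evolve deterministically forwards and repelling ones deterministically
   backwards, and on the recurrent part of a finite graph the two amount to the
   same. *)

Set Implicit Arguments.
Unset Strict Implicit.
Unset Printing Implicit Defensive.

Import Order.TTheory GRing.Theory Num.Theory.
Import numFieldNormedType.Exports.
Local Open Scope classical_set_scope.
Local Open Scope ring_scope.

(** * Walks in finite digraphs *)

Section digraph.
Local Open Scope nat_scope.
Variables (J : finType) (E : rel J).
Implicit Types (u v w : J) (p : seq J) (n : nat).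

(** These are the edges inside a strongly connected component. *)
Definition returning v w := E v w && connect E w v.

Definition return_unique :=
  forall v w w', returning v w -> returning v w' -> w = w'.

Definition reach v := #|connect E v|.

Lemma reach_gt0 v : 0 < reach v.
Proof. by apply/card_gt0P; exists v; rewrite inE connect0. Qed.

Lemma reach_max v : reach v <= #|J|.
Proof. exact: max_card. Qed.

Lemma leq_reach v w : E v w -> reach w <= reach v.
Proof.
move=> vw; apply/subset_leq_card/fintype.subsetP => u; rewrite !inE.
exact/connect_trans/connect1.
Qed.

(** The vertex [v] itself is reachable from [v] but no longer from [w]. *)
Lemma ltn_reach v w : E v w -> ~~ returning v w -> reach w < reach v.
Proof.
rewrite /returning => vw; rewrite vw /= => nwv.
apply/proper_card/properP; split; last by exists v; rewrite !inE ?connect0.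
by apply/fintype.subsetP => u; rewrite !inE; exact/connect_trans/connect1.
Qed.

Fixpoint walks n v : seq (seq J) :=
  if n is n'.+1 then
    [seq v :: p | w <- [seq w <- enum J | E v w], p <- walks n' w]
  else [:: [:: v]].

Lemma mem_walks v p : path E v p -> v :: p \in walks (size p) v.
Proof.
elim: p v => [|w p ih] v /=; first by rewrite inE.
move=> /andP[vw /ih wp]; apply/allpairsPdep; exists w, (w :: p).
by split => //; rewrite mem_filter vw mem_enum.
Qed.

Lemma sum_lower_bound (P : pred J) (F : J -> nat) M :
  (forall v, P v -> F v <= M) -> \sum_(v | P v) F v <= #|J| * M.
Proof.
move=> FM; apply: (@leq_trans (\sum_(v | P v) M)); first exact: leq_sum.
by rewrite sum_nat_const leq_mul2r max_card orbT.
Qed.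

(* Of the first steps of a walk from [v] at most one can return to [v], and all
   others decrease [reach]. *)
Lemma size_walks n v : return_unique ->
  size (walks n v) <= (#|J| * n.+1) ^ reach v.
Proof.
move=> uniqE; have J0 : 0 < #|J| by apply/card_gt0P; exists v.
elim: n v => [|n ih] v; first by rewrite /= expn_gt0 muln1 J0.
have [r rE] : exists r, reach v = r.+1 by exists (reach v).-1; rewrite prednK// reach_gt0.
rewrite /= size_allpairs_dep sumnE !big_map big_filter big_enum_cond/=.
rewrite (bigID (returning v))/= rE.
set C := #|J| * n.+1.
have C0 : 0 < C by rewrite muln_gt0 J0.
have ret : \sum_(w | E v w && returning v w) size (walks n w) <= C ^ r.+1.
  have [w /andP[vw rw]|none] := pickP [pred w | E v w && returning v w].
    rewrite (bigD1 w)/= ?vw// big1 ?addn0 => [|w' /andP[/andP[_ rw'] nw]].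
      by apply: leq_trans (ih w) _; rewrite leq_pexp2l// -rE leq_reach.
    by rewrite (uniqE _ _ _ rw rw') eqxx in nw.
  by rewrite big_pred0.
have low : \sum_(w | E v w && ~~ returning v w) size (walks n w) <= #|J| * C ^ r.
  apply: sum_lower_bound => w /andP[vw rw]; apply: leq_trans (ih w) _.
  by rewrite leq_pexp2l// -ltnS -rE ltn_reach.
apply: leq_trans (leq_add ret low) _.
(* The two contributions add up to (C + |J|) * C ^ r, where C + |J| = |J| * (n + 2) is the base of
   the bound for the next length. *)
rewrite expnS -mulnDl (_ : C + #|J| = #|J| * n.+2); last by rewrite (mulnS _ n.+1) addnC.
rewrite expnS leq_mul2l; apply/orP; right.
by case: (r) => [|r2]; rewrite ?expn0// leq_exp2r// leq_mul2l leqnSn orbT.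
Qed.

End digraph.

(** * Codings and Li-Yorke pairs *)

(** Edges also record transitions with an error below [delta], which makes the notion stable under
    perturbation of [f]. Cells of a nontrivial finite partition of a connected space cannot all be a
    positive distance apart, so separation is asked only of cells with a returning edge. *)
Record coding (R : realType) (T : Type) (d : T -> T -> R) (f : T -> T)
    (e delta : R) (J : finType) (E : rel J) (c : T -> J) : Prop := Coding {
  coding_gt0 : 0 < delta ;
  coding_edge : forall x y, d (f x) y < delta -> E (c x) (c y) ;
  coding_unique : return_unique E ;
  coding_small : forall x y, c x = c y -> d x y <= e ;
  coding_separated : forall x y v w, returning E (c x) v -> returning E (c y) w ->
    c x <> c y -> delta <= d x y
}.

Definition coded (R : realType) (T : Type) (d : T -> T -> R) (f : T -> T) (e : R) :=
  exists delta (J : finType) (E : rel J) (c : T -> J), coding d f e delta E c.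

Lemma coded_le (R : realType) (T : Type) (d : T -> T -> R) (f : T -> T) (e e' : R) :
  e <= e' -> coded d f e -> coded d f e'.
Proof.
move=> ee' [delta [J [E [c [? ? ? small ?]]]]]; exists delta, J, E, c; split => //.
by move=> x y /small/le_trans; exact.
Qed.

Lemma noninc_nat_stable (u : nat -> nat) : (forall n, (u n.+1 <= u n)%N) ->
  exists N, forall n, (N <= n)%N -> u n = u N.
Proof.
move=> ud; have {ud} ule : forall m n, (m <= n)%N -> (u n <= u m)%N.
  move=> m; elim=> [|n ih]; first by rewrite leqn0 => /eqP->.
  rewrite leq_eqVlt => /predU1P[->//|]; rewrite ltnS => /ih; exact: leq_trans.
(* Induction on a bound for the initial value: if the sequence ever drops below it, the shifted
   sequence starts lower. *)
have [k] := ubnP (u 0%N); elim: k u ule => // k ih u ule uk.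
have [[m um]|h] := pselect (exists m, (u m < u 0)%N); last first.
  exists 0%N => n _; apply/eqP; rewrite eqn_leq ule//=.
  by rewrite leqNgt; apply/negP => un; apply: h; exists n.
have [|/=|N hN] := ih (fun n => u (m + n)%N).
- by move=> a b ab; apply: ule; rewrite leq_add2l.
- by rewrite addn0 (leq_trans um)// -ltnS.
exists (m + N)%N => n mn; have := hN (n - m)%N; rewrite subnKC.
  by apply; lia.
by lia.
Qed.

Section no_li_yorke.
Context (R : realType) (T : topologicalType) (d : T -> T -> R).
Context (cT : compact [set: T]) (dT : compatible_metric d).
Variable f : T -> T.

Lemma coding_edge_iter e delta (J : finType) (E : rel J) (c : T -> J) x n :
  coding d f e delta E c -> E (c (iter n f x)) (c (iter n.+1 f x)).
Proof.
by move=> cf; apply: (coding_edge cf); rewrite (cmetric_xx dT) (coding_gt0 cf).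
Qed.

Lemma coding_eventually_returning e delta (J : finType) (E : rel J) (c : T -> J) x :
  coding d f e delta E c ->
  exists N, forall n, (N <= n)%N ->
    returning E (c (iter n f x)) (c (iter n.+1 f x)).
Proof.
move=> cf.
have [|N NP] := @noninc_nat_stable (fun n => reach E (c (iter n f x))).
  by move=> n; apply: leq_reach; exact: coding_edge_iter cf.
exists N => n Nn; apply/negPn/negP => /(ltn_reach (coding_edge_iter x n cf)).
by rewrite (NP n.+1) 1?(NP n)// ?ltnn// (leq_trans Nn).
Qed.

Lemma orbit_dist_bounded x y :
  bounded_fun (fun n => d (iter n f x) (iter n f y)).
Proof.
have [M dM] := cmetric_bounded cT dT.
exists M; split; first exact: num_real.
move=> N MN n _ /=; rewrite ger0_norm ?(cmetric_ge0 dT)//.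
exact: le_trans (dM _ _) (ltW MN).
Qed.

(** From some time on both orbits use returning edges only. If their cells ever coincide after that,
    uniqueness of returning successors keeps them equal forever; if never, the distances stay at
    least [delta] and the lower limit is positive. *)
Lemma coded_li_yorke e x y : coded d f e ->
  limn_inf (fun n => d (iter n f x) (iter n f y)) = 0 ->
  limn_sup (fun n => d (iter n f x) (iter n f y)) <= e.
Proof.
move=> [delta [J [E [c cf]]]].
set u := fun n => d _ _; have bu : bounded_fun u := orbit_dist_bounded x y.
have [N1 xN] := coding_eventually_returning x cf.
have [N2 yN] := coding_eventually_returning y cf.
pose N := maxn N1 N2.
have {}xN n : (N <= n)%N -> returning E (c (iter n f x)) (c (iter n.+1 f x)).
  by move=> Nn; apply: xN; rewrite (leq_trans _ Nn)// leq_maxl.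
have {}yN n : (N <= n)%N -> returning E (c (iter n f y)) (c (iter n.+1 f y)).
  by move=> Nn; apply: yN; rewrite (leq_trans _ Nn)// leq_maxr.
have [[m Nm cm] _|nc] := pselect (exists2 m, (N <= m)%N & c (iter m f x) = c (iter m f y)).
  have same n : (m <= n)%N -> c (iter n f x) = c (iter n f y).
    elim: n => [|n ih]; first by rewrite leqn0 => /eqP m0; rewrite m0 in cm.
    rewrite leq_eqVlt => /predU1P[<-//|]; rewrite ltnS => mn.
    apply: (coding_unique cf (xN n _) _); first exact: leq_trans mn.
    by rewrite ih//; apply: yN; exact: leq_trans mn.
  rewrite (limn_supE bu); apply: (@le_trans _ _ (sups u m)).
    by apply: ge_inf; [exact: bounded_fun_has_lbound_sups|exists m].
  apply: ge_sup; first by exists (u m), m => /=.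
  by move=> _ [n /= mn <-]; apply: (coding_small cf); exact: same.
suff : delta <= limn_inf u by move=> + u0; rewrite u0 leNgt (coding_gt0 cf).
rewrite (limn_infE bu); apply: (@le_trans _ _ (infs u N)).
  apply: lb_le_inf; first by exists (u N), N => /=.
  move=> _ [n /= Nn <-]; apply: (coding_separated cf (xN n Nn) (yN n Nn)).
  by move=> cn; apply: nc; exists n.
by apply: ub_le_sup; [exact: bounded_fun_has_ubound_infs|exists N].
Qed.

Lemma coded_no_li_yorke : (forall k : nat, coded d f k.+1%:R^-1) ->
  ~ exists x y, li_yorke_pair d f x y.
Proof.
move=> cf [x [y [inf0 sup0]]].
have [k _ ksup] := near_infty_natSinv_lt (PosNum sup0).
have /= := ksup k (leqnn k); rewrite ltNge => /negP; apply.
exact: coded_li_yorke (cf k) inf0.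
Qed.

End no_li_yorke.

(** * Codings and entropy *)

Section zero_entropy.
Context (R : realType) (T : topologicalType) (d : T -> T -> R).
Context (dT : compatible_metric d).
Variable f : T -> T.

(** Two points with the same itinerary of [n.+1] cells have Bowen distance at most [e], so a
    separated set injects into the walks with [n] edges. One factor |J| counts the starting
    vertices. *)
Lemma coded_card_separated e : 0 <= e -> coded d f e ->
  exists B C K : nat, forall n (A : {fset T}), Defs.separated d f n.+1 e A ->
    (#|` A| <= B * (C * n.+1) ^ K)%N.
Proof.
move=> e0 [delta [J [E [c cf]]]]; exists #|J|, #|J|, #|J| => n A sepA.
pose word x := [seq c (iter i f x) | i <- iota 0 n.+1].
have word_path m x i : path E (c (iter i f x)) [seq c (iter j f x) | j <- iota i.+1 m].
  elim: m i => //= m ih i; apply/andP; split; last exact: (ih i.+1).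
  exact: (coding_edge_iter dT x i cf).
have wordW x : word x \in flatten [seq walks E n v | v <- enum J].
  apply/flatten_mapP; exists (c x); first by rewrite mem_enum.
  have := mem_walks (word_path n x 0%N).
  by rewrite size_map size_iota.
have word_inj : {in A &, injective word}.
  move=> x y xA yA xy; apply/eqP/negPn/negP => nxy.
  have := sepA x y xA yA nxy; rewrite ltNge => /negP; apply.
  rewrite /bowen_dist; apply: bigmax_le => // i _.
  apply: (coding_small cf).
  have := congr1 (fun s => nth (c x) s i) xy.
  by rewrite !(nth_map 0%N) ?size_iota// nth_iota// add0n.
have -> : #|` A| = size (map word A) by rewrite size_map.
apply: (@leq_trans (size (flatten [seq walks E n v | v <- enum J]))).
  apply: uniq_leq_size; first by rewrite map_inj_in_uniq// fset_uniq.
  by move=> _ /mapP[x _ ->].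
rewrite size_flatten /shape -map_comp sumnE big_map big_enum/=.
apply: (@leq_trans (\sum_(v : J) (#|J| * n.+1) ^ #|J|)%N); last by rewrite sum_nat_const.
apply: leq_sum => v _; apply: leq_trans (size_walks n v (coding_unique cf)) _.
by rewrite leq_pexp2l ?reach_max// muln_gt0 andbT; apply/card_gt0P; exists v.
Qed.

Lemma ln_poly_sublinear (B C K : nat) (a : R) : 0 < a ->
  exists N, forall n, (N <= n)%N ->
    ln (B.+1 * (C.+1 * n.+1) ^ K)%N%:R <= a * n.+1%:R.
Proof.
move=> a0.
(* With this [c] the term [K * ln n.+1], bounded through ln (c * n.+1) <= c * n.+1, costs at most
   half of the allowed slope [a]; the constants collected in [D] are absorbed by the other half once
   [n] is large. *)
pose c := a / (2 * K.+1%:R).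
have c0 : 0 < c by rewrite divr_gt0// mulr_gt0.
pose D := ln B.+1%:R + K%:R * ln C.+1%:R - K%:R * ln c.
exists (Num.bound `|2 * D / a|) => n Nn.
have ltn : 2 * D / a < n.+1%:R.
  apply: le_lt_trans (ler_norm _) _; apply: lt_le_trans (archi_boundP (normr_ge0 _)) _.
  by rewrite ler_nat (leq_trans Nn).
have -> : ln ((B.+1 * (C.+1 * n.+1) ^ K)%N%:R : R) =
    ln B.+1%:R + K%:R * (ln C.+1%:R + ln n.+1%:R).
  rewrite natrM natrX natrM lnM ?posrE ?exprn_gt0 ?mulr_gt0//.
  by rewrite lnXn ?mulr_gt0// lnM ?posrE// mulr_natl.
have lnn : ln n.+1%:R <= c * n.+1%:R - ln c.
  rewrite lerBrDl -lnM ?posrE// ltW// ln_sublinear// mulr_gt0//.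
have Kc : K%:R * c <= a / 2.
  have KK : K%:R <= K.+1%:R :> R by rewrite ler_nat.
  rewrite /c mulrA ler_pdivrMr ?mulr_gt0//.
  by have := ler_wpM2r (ltW a0) KK; lra.
have K0 : 0 <= K%:R :> R by [].
have n0 : 0 <= n.+1%:R :> R by [].
have Da : D <= a / 2 * n.+1%:R.
  by move: ltn; rewrite ltr_pdivrMr// => /ltW; lra.
have := ler_wpM2l K0 lnn; have := ler_wpM2r n0 Kc; move: Da; rewrite /D.
by lra.
Qed.

(** Polynomial growth of separated sets bounds the rate from above by every positive [a]; a
    singleton is separated, so the logarithms are nonnegative. *)
Lemma coded_entropy_at_scale e (x0 : T) : 0 < e -> coded d f e ->
  entropy_at_scale d f e = 0%E.
Proof.
move=> e0 /(coded_card_separated (ltW e0))[B [C [K bound]]].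
have max1 n : (1 <= max_separated d f n e)%E.
  apply: ereal_sup_ubound; exists [fset x0]%fset; last by rewrite cardfs1.
  by move=> x y /fset1P-> /fset1P->; rewrite eqxx.
(* Passing to the successors of [B] and [C] keeps the bound positive, so that its logarithm behaves
   even if one of them is 0. *)
have maxB n : (max_separated d f n.+1 e <= (B.+1 * (C.+1 * n.+1) ^ K)%N%:R%:E)%E.
  apply: ge_ereal_sup => _ [A sepA <-]; rewrite lee_fin ler_nat.
  apply: leq_trans (bound _ _ sepA) _; rewrite leq_mul//.
  by case: (K) => [|k]; rewrite ?expn0// leq_exp2r// leq_mul.
apply/eqP; rewrite eq_le; apply/andP; split; last first.
  apply: limf_esup_ge0 => [[N _ /(_ N)]|n]; first by apply => /=.
  by rewrite mule_ge0 ?lee_fin ?invr_ge0// lne_ge0.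
apply/lee_addgt0Pr => a a0; rewrite add0e.
have [N Nle] := ln_poly_sublinear B C K a0.
rewrite /entropy_at_scale /limn_esup limf_esupE.
apply: le_trans (ereal_inf_lbound _) _.
  by exists [set n | (N < n)%N] => //; exists N.+1.
apply: ge_ereal_sup => _ [[//|n] /= Nn <-].
apply: (@le_trans _ _ ((n.+1%:R^-1)%:E * (ln (B.+1 * (C.+1 * n.+1) ^ K)%N%:R)%:E)%E).
  rewrite lee_pmul2l ?lte_fin// -lne_EFin ?ltr0n ?muln_gt0 ?expn_gt0//.
  rewrite lee_lne// ?in_itv/= ?leey ?andbT//.
  by rewrite (le_trans _ (max1 _)).
by rewrite -EFinM lee_fin mulrC ler_pdivrMr// Nle.
Qed.

Lemma coded_entropy (x0 : T) : (forall k : nat, coded d f k.+1%:R^-1) ->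
  topological_entropy d f = 0%E.
Proof.
move=> cf.
have code e : 0 < e -> coded d f e.
  move=> e0; have [k _ /(_ k (leqnn k))/= ke] := near_infty_natSinv_lt (PosNum e0).
  exact: coded_le (ltW ke) (cf k).
apply: cvg_lim => //; apply: cvg_near_cst.
by near=> e; rewrite coded_entropy_at_scale//; apply: code.
Unshelve. all: by end_near. Qed.

End zero_entropy.

(** * Reduction to density *)

(** Since [meager] asks for an equality with a union, the complements of the [U k] are cut down to
    the complement of [S]. *)
Lemma open_dense_comeager (T : topologicalType) (U : (set T)^nat) (S : set T) :
  (forall k, open (U k)) -> (forall k, dense (U k)) ->
  \bigcap_k U k `<=` S -> comeager S.
Proof.
move=> Uo Ud US; exists (fun k => ~` S `&` ~` U k); last first.
  rewrite -setI_bigcupr -setC_bigcap; apply/esym/setIidPl.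
  exact: subsetC.
move=> k; apply/seteqP; split => // x Ax.
have [|y [yA yU]] := Ud k (interior (closure (~` S `&` ~` U k))) _ (@open_interior _ _).
  by exists x.
by have /(_ _ (open_nbhs_nbhs (conj (Uo k) yU)))[z [[_ nU] /nU]] := interior_subset yA.
Qed.

Section generic.
Context (R : realType) (T : topologicalType) (d : T -> T -> R).
Context (cT : compact [set: T]) (dT : compatible_metric d).
Local Notation H := (homeo_space cT dT).

Lemma homeo_ballE (f : H) r : ball f r = [set g : H | sup_dist d f g < r].
Proof. by rewrite ballEmdist. Qed.

Lemma dist_le_sup_dist (f g : T -> T) x : d (f x) (g x) <= sup_dist d f g.
Proof.
apply: ub_le_sup; last by exists x.
by have [M dM] := cmetric_bounded cT dT; exists M => _ [y _ <-].
Qed.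

Lemma sup_dist_lt (x0 : T) (f g : T -> T) r r' : r < r' ->
  (forall x, d (f x) (g x) <= r) -> sup_dist d f g < r'.
Proof.
move=> rr' fg; apply: le_lt_trans rr'.
by apply: ge_sup => [|_ [x _ <-]//]; exists (d (f x0) (g x0)), x0.
Qed.

(** The same cells and graph serve every [g] within [delta / 2] of [f]: an error below [delta / 2]
    for [g] is an error below [delta] for [f]. *)
Lemma open_coded e : open [set f : H | coded d f e].
Proof.
rewrite openE => f [delta [J [E [c cf]]]]; rewrite /interior -nbhs_ballE.
have d2 : 0 < delta / 2 by rewrite divr_gt0// (coding_gt0 cf).
exists (delta / 2) => //= g; rewrite homeo_ballE/= => fg.
exists (delta / 2), J, E, c; split => //.
- move=> x y gxy; apply: (coding_edge cf).
  apply: le_lt_trans (cmetric_triangle dT (g x) _ _) _.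
  rewrite [ltRHS]splitr ltrD//.
  exact: le_lt_trans (dist_le_sup_dist _ _ _) fg.
- exact: coding_unique cf.
- exact: coding_small cf.
- move=> x y v w xv yw nc; have := coding_separated cf xv yw nc.
  by move: d2; lra.
Qed.

Lemma dense_coded_generic (x0 : T) :
  (forall (f : H) e a, 0 < e -> 0 < a ->
    exists2 g : H, coded d g e & forall x, d (f x) (g x) <= a) ->
  comeager [set f : H | ~ exists x y, li_yorke_pair d f x y] /\
  comeager [set f : H | topological_entropy d f = 0%E].
Proof.
move=> dens.
pose U k := [set f : H | coded d f k.+1%:R^-1].
have Uo k : open (U k) by exact: open_coded.
have Ud k : dense (U k).
  move=> O [f Of] Oo.
  have := open_nbhs_nbhs (conj Oo Of); rewrite -nbhs_ballE => -[r /= r0 rO].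
  have [||g gU fg] := dens f k.+1%:R^-1 (r / 2); rewrite ?divr_gt0//.
  exists g; split => //; apply: rO; rewrite homeo_ballE/=.
  by apply: (sup_dist_lt x0) fg; move: r0; lra.
split; apply: (open_dense_comeager Uo Ud) => f fU /=.
- by apply: (coded_no_li_yorke cT dT) => k; exact: fU.
- by apply: (coded_entropy dT x0) => k; exact: fU.
Qed.

End generic.

(** * Coordinates on the fan *)

Definition agree (n : nat) (x y : cantor_space) := forall i, (i < n)%N -> x i = y i.

Lemma agree_sym n x y : agree n x y -> agree n y x.
Proof. by move=> xy i /xy. Qed.

Lemma agree_trans n y x z : agree n x y -> agree n y z -> agree n x z.
Proof. by move=> xy yz i /[dup]/xy-> /yz. Qed.

Lemma agreeW m n x y : (m <= n)%N -> agree n x y -> agree m x y.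
Proof. by move=> mn xy i im; apply: xy; exact: leq_trans mn. Qed.

Lemma nbhs_bit (x : cantor_space) i : nbhs x [set y : cantor_space | x i = y i].
Proof.
have := @proj_continuous nat (fun=> bool) i x.
by move=> /(_ [set x i]); rewrite /proj => h; apply: filterS (h (discrete_set1 _)) => y /= ->.
Qed.

Lemma nbhs_agree n (x : cantor_space) : nbhs x (agree n x).
Proof.
elim: n => [|n ih]; first by apply: filterS filterT => y _ i.
apply: filterS (filterI ih (nbhs_bit x n)) => y [xy xyn] i.
by rewrite ltnS leq_eqVlt => /predU1P[->//|/xy].
Qed.

Lemma cantor_nbhsP (x : cantor_space) (A : set cantor_space) :
  nbhs x A <-> exists n, agree n x `<=` A.
Proof.
split=> [|[n nA]]; last exact: filterS nA (nbhs_agree n x).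
pose F := filter_from [set: nat] (fun n => agree n x).
have FF : ProperFilter F.
  apply: filter_from_proper; last by move=> n _; exists x.
  apply: filter_from_filter; first by exists 0%N.
  move=> i j _ _; exists (maxn i j) => // y xy.
  by split; apply: agreeW xy; rewrite ?leq_maxl ?leq_maxr.
suff /[apply] : F --> x by move=> [n _ nA]; exists n.
(* The topology is the supremum of the coordinate topologies, and coordinate [i] is constant on
   cylinders of depth [i.+1]. *)
apply/cvg_sup => i U [V] [[W] oW <-] Wx WU.
by apply: (filterS WU); exists i.+1 => // y xy /=; rewrite -(xy i).
Qed.

Lemma continuous_cantorP (X : topologicalType) (f : X -> cantor_space) :
  (forall x n, \forall y \near x, agree n (f x) (f y)) -> continuous f.
Proof. by move=> fc x A /cantor_nbhsP[n nA]; apply: filterS (fc x n) => y /nA. Qed.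

Section fan_coordinates.
Variable R : realType.
Implicit Types (x y : cantor_space) (s t : R) (p q : cantor_fan R).

Lemma clamp_proof t : Num.max 0 (Num.min t 1) \in `[0 : R, 1]%classic.
Proof.
by rewrite inE /= in_itv /= le_max lexx /= ge_max ler01 ge_min lexx orbT.
Qed.

Definition clamp t : unit_interval R := SigSub (clamp_proof t).

Lemma clamp_id t : 0 <= t <= 1 -> val (clamp t) = t.
Proof. by move=> /andP[t0 t1] /=; rewrite (min_idPl t1) (max_idPr t0). Qed.

Lemma continuous_clamp : continuous clamp.
Proof.
apply: (@continuous_comp_initial (unit_interval R) R R set_val clamp).
have -> : set_val \o clamp = fun t : R => Num.max 0 (Num.min t 1).
  by apply/funext => t /=; rewrite set_valE.
move=> t; apply: (@continuous_max R R (cst 0) (id \min cst 1)).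
  exact: cvg_cst.
by apply: (@continuous_min R R id (cst 1)); [exact: cvg_id | exact: cvg_cst].
Qed.

(** The height is an arbitrary real, clamped to the unit interval, so that rays are continuous maps
    on the whole line. *)
Definition fan_pt x t : cantor_fan R := \pi_(cantor_fan R)%qT (x, clamp t).

Definition height p : R := val (repr p).2.

(* Arbitrary when [p] is the apex. *)
Definition blade p : cantor_space := (repr p).1.

Lemma height_itv p : 0 <= height p <= 1.
Proof. by have := set_mem (valP (repr p).2); rewrite /= in_itv. Qed.

Lemma height_ge0 p : 0 <= height p. Proof. by have /andP[] := height_itv p. Qed.

Lemma height_le1 p : height p <= 1. Proof. by have /andP[] := height_itv p. Qed.

Lemma fan_ptK p : fan_pt (blade p) (height p) = p.
Proof.
rewrite /fan_pt (_ : clamp (height p) = (repr p).2).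
  by rewrite -[LHS]/(\pi_(cantor_fan R)%qT _) -surjective_pairing reprK.
by apply/val_inj; rewrite clamp_id// height_itv.
Qed.

Lemma fan_ptP x t : 0 <= t <= 1 ->
  height (fan_pt x t) = t /\ (0 < t -> blade (fan_pt x t) = x).
Proof.
move=> t01.
have : fan_rel (repr (fan_pt x t)) (x, clamp t).
  by have /eqquotP := reprK (fan_pt x t).
rewrite /fan_rel => /orP[/eqP e|/andP[/eqP h0 /eqP ct0]].
  by rewrite /height /blade e clamp_id.
have t0 : t = 0 by rewrite -(clamp_id t01).
rewrite /height h0 t0 ltxx; split => //.
Qed.

Lemma fan_pt0 x y : fan_pt x 0 = fan_pt y 0.
Proof.
have c0 : val (clamp 0) = 0 by rewrite clamp_id// lexx ler01.
by apply/eqquotP/orP; right; apply/andP; split; apply/eqP.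
Qed.

Definition apex := fan_pt point 0.

Lemma height_eq0 p : height p = 0 -> p = apex.
Proof. by move=> p0; rewrite -[p]fan_ptK p0 (fan_pt0 _ point). Qed.

Lemma height_apex : height apex = 0.
Proof. by have [] := @fan_ptP point 0; rewrite ?lexx ?ler01. Qed.

Lemma continuous_fan_pt : continuous (fun z : cantor_space * R => fan_pt z.1 z.2).
Proof.
move=> z; apply: (@continuous_comp _ _ _ (fun z : cantor_space * R => (z.1, clamp z.2))
  (\pi_(cantor_fan R)%qT)); last exact: pi_continuous.
apply: (@cvg_pair _ _ _ _ (nbhs z.1) (nbhs (clamp z.2))); first exact: cvg_fst.
apply: (@continuous_comp _ _ _ snd clamp); first exact: cvg_snd.
exact: continuous_clamp.
Qed.

Lemma continuous_fan (Z : topologicalType) (f : cantor_fan R -> Z) :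
  continuous (fun z : cantor_space * unit_interval R => f (\pi_(cantor_fan R)%qT z)) ->
  continuous f.
Proof. by move=> fc; apply/(@quotient_continuous _ {eq_quot fan_equiv R}%qT Z f). Qed.

Lemma continuous_height : continuous height.
Proof.
apply: continuous_fan.
have htE (z : cantor_space * unit_interval R) :
    height (\pi_(cantor_fan R)%qT z) = set_val z.2.
  case: z => x t; rewrite set_valE.
  have t01 : 0 <= val t <= 1 by have := set_mem (valP t); rewrite /= in_itv.
  have {1}-> : t = clamp (val t) by apply/val_inj; rewrite clamp_id.
  by have [-> _] := fan_ptP x t01.
have -> : (fun z : cantor_space * unit_interval R => height (\pi_(cantor_fan R)%qT z)) =
    fun z => set_val z.2 by apply/funext.
move=> z; apply: (@continuous_comp _ _ _ snd (set_val : unit_interval R -> R)).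
  exact: cvg_snd.
exact: initial_continuous.
Qed.

End fan_coordinates.

Section fan_metric.
Context (R : realType) (d : cantor_fan R -> cantor_fan R -> R).
Context (dC : compatible_metric d).
Implicit Types (x y : cantor_space) (s t : R) (p q : cantor_fan R).

Lemma metric_nbhsP p (A : set (cantor_fan R)) :
  nbhs p A <-> exists2 e, 0 < e & forall q, d p q < e -> A q.
Proof.
rewrite (cmetric_nbhs dC); split=> [[e /= e0 eA]|[e e0 eA]]; first by exists e.
by exists e.
Qed.

(** Off the apex the quotient map is injective, and the set in question pulls back to a product of a
    cylinder and an open set of heights. *)
Lemma blade_near p n : 0 < height p -> \forall q \near p, agree n (blade p) (blade q).
Proof.
move=> p0; pose U := [set q : cantor_fan R | 0 < height q /\ agree n (blade p) (blade q)].
suff Uo : open U.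
  by apply: filterS (open_nbhs_nbhs (conj Uo _)) => [q []//|]; split.
rewrite /open/= /quotient_open.
rewrite (_ : _ @^-1` U = ([set x | agree n (blade p) x] `*` [set t | 0 < set_val t])); last first.
  apply/seteqP; split => -[x t] /=; rewrite set_valE.
    have t01 : 0 <= val t <= 1 by have := set_mem (valP t); rewrite /= in_itv.
    have -> : \pi_(cantor_fan R)%qT (x, t) = fan_pt x (val t).
      by congr (\pi_(_)%qT (_, _)); apply/val_inj; rewrite clamp_id.
    by move=> [] ; have [-> h] := fan_ptP x t01 => /[dup] /h->.
  move=> [xp t0].
  have t01 : 0 <= val t <= 1 by have := set_mem (valP t); rewrite /= in_itv.
  have -> : \pi_(cantor_fan R)%qT (x, t) = fan_pt x (val t).
    by congr (\pi_(_)%qT (_, _)); apply/val_inj; rewrite clamp_id.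
  by have [h1 h2] := fan_ptP x t01; split; rewrite ?h1 ?h2.
rewrite openE => -[x t] [/= xp t0]; exists ([set x | agree n (blade p) x], [set t | 0 < set_val t]) => //=.
split; last first.
  have := @initial_continuous _ _ (set_val : unit_interval R -> R) t.
  by move=> /(_ [set s : R | 0 < s]); apply; exact: lt_nbhsr.
apply/cantor_nbhsP; exists n => y; exact: agree_trans.
Qed.

Lemma near_inv_nat e : 0 < e -> \forall n \near \oo, n.+1%:R^-1 < e :> R.
Proof. by move=> e0; have := near_infty_natSinv_lt (PosNum e0). Qed.

(** Compactness is applied to the pair ([x], [t]) alone, with [n] as the parameter of the
    near-covering property; this leaves [s] free to range over all reals. *)
Lemma fan_pt_unif e : 0 < e -> exists n, forall x y t s, 0 <= t <= 1 ->
  agree n x y -> `|t - s| < n.+1%:R^-1 -> d (fan_pt x t) (fan_pt y s) < e.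
Proof.
move=> e0.
have cK : compact ([set: cantor_space] `*` `[0 : R, 1]%classic).
  exact: (compact_setX cantor_space_compact (@segment_compact R 0 1)).
pose P n (z : cantor_space * R) := forall y s, agree n z.1 y ->
  `|z.2 - s| < n.+1%:R^-1 -> d (fan_pt z.1 z.2) (fan_pt y s) < e.
have : \forall n \near \oo, ([set: cantor_space] `*` `[0 : R, 1]%classic) `<=` P n.
  move/compact_near_coveringP : cK; apply => -[x0 t0] _.
  have /metric_nbhsP : exists2 a, 0 < a & forall q, d (fan_pt x0 t0) q < a ->
      d (fan_pt x0 t0) q < e / 2 by exists (e / 2); rewrite ?divr_gt0.
  move=> /(@continuous_fan_pt R (x0, t0)) [[A B] [/= xA tB] AB].
  have [n0 n0A] := (cantor_nbhsP _ _).1 xA.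
  have [r /= r0 rB] := (nbhs_ballP _ _).1 tB.
  have close x t : agree n0 x0 x -> `|t0 - t| < r -> d (fan_pt x0 t0) (fan_pt x t) < e / 2.
    by move=> x0x t0t; apply: (AB (x, t)); split; [exact: n0A|exact: rB].
  exists ([set z | agree n0 x0 z.1 /\ `|t0 - z.2| < r / 2],
    [set n | (n0 <= n)%N /\ n.+1%:R^-1 < r / 2]) => /=.
    split.
      exists (agree n0 x0, ball t0 (r / 2)) => [/=|[x t] []//].
      by split; [exact: nbhs_agree|apply: nbhsx_ballx; rewrite divr_gt0].
    apply: filterI; first by exists n0.
    by apply: near_inv_nat; rewrite divr_gt0.
  move=> [[x t] n] /= [[xx0 tt0] [nn0 nr]] y s /= xy ts.
  apply: le_lt_trans (cmetric_triangle dC (fan_pt x0 t0) _ _) _.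
  rewrite (cmetric_sym dC _ (fan_pt x0 t0)) [ltRHS]splitr ltrD//.
    by apply: close => //; apply: lt_le_trans tt0 _; move: r0; lra.
  apply: close; first exact: agree_trans xx0 (agreeW nn0 xy).
  apply: le_lt_trans (ler_distD t t0 s) _.
  by rewrite [ltRHS]splitr ltrD// (lt_trans ts).
move=> /filter_ex[n nP]; exists n => x y t s t01 xy ts.
by apply: (nP (x, t)) => //; split => //=; rewrite in_itv.
Qed.

Lemma fan_unif e : 0 < e -> exists n, forall p q,
  agree n (blade p) (blade q) -> `|height p - height q| < n.+1%:R^-1 -> d p q < e.
Proof.
move=> /fan_pt_unif[n nP]; exists n => p q pq hpq.
by rewrite -[p]fan_ptK -[q]fan_ptK; apply: nP; rewrite // height_itv.
Qed.

Lemma apex_unif e : 0 < e -> exists2 a, 0 < a & forall p, height p < a -> d p (apex R) < e.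
Proof.
move=> /fan_pt_unif[n nP]; exists n.+1%:R^-1 => // p pn.
rewrite -[p]fan_ptK /apex -(fan_pt0 _ (blade p)); apply: nP => //; first exact: height_itv.
by rewrite subr0 ger0_norm// height_ge0.
Qed.

(** Again by compactness. Blades are uncontrolled at the apex, whence the guard [a <= height p]:
    around the apex all heights are below [a] and the second claim is vacuous. *)
Lemma height_unif a n : 0 < a -> exists2 e, 0 < e & forall p q, d p q < e ->
  `|height p - height q| < a /\ (a <= height p -> agree n (blade p) (blade q)).
Proof.
move=> a0.
pose P k p := forall q, d p q < k.+1%:R^-1 ->
  `|height p - height q| < a /\ (a <= height p -> agree n (blade p) (blade q)).
have : \forall k \near \oo, [set: cantor_fan R] `<=` P k.
  move/compact_near_coveringP : (@cantor_fan_compact R); apply => p0 _.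
  have near2 A : nbhs p0 A -> exists2 r, 0 < r & forall p q, d p0 p < r -> d p q < r -> A p /\ A q.
    move=> /metric_nbhsP[r r0 rA]; exists (r / 2); rewrite ?divr_gt0// => p q pp0 pq.
    split; apply: rA; first by move: pp0 r0; lra.
    by have := cmetric_triangle dC p p0 q; move: pp0 pq; lra.
  have [r r0 rP] : exists2 r, 0 < r & forall p q, d p0 p < r -> d p q < r ->
     `|height p - height q| < a /\ (a <= height p -> agree n (blade p) (blade q)).
    have hnear : \forall q \near p0, `|height p0 - height q| < a / 2.
      have := @continuous_height R p0; move=> /cvgrPdist_lt; apply.
      by rewrite divr_gt0.
    have hd p q : `|height p0 - height p| < a / 2 -> `|height p0 - height q| < a / 2 ->
        `|height p - height q| < a.
      by have := ler_distD (height p0) (height p) (height q);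
         rewrite (distrC (height p) (height p0)); lra.
    have [p00|p00] := ltP 0 (height p0).
      have [r r0 rA] := near2 _ (filterI hnear (blade_near n p00)).
      exists r => // p q pp0 pq; have [[hp bp] [hq bq]] := rA p q pp0 pq.
      split=> [|_]; first exact: hd.
      exact: agree_trans (agree_sym bp) bq.
    have [r r0 rA] := near2 _ hnear.
    exists r => // p q pp0 pq; have [hp hq] := rA p q pp0 pq.
    split=> [|ap]; first exact: hd.
    by exfalso; move: hp; rewrite ltr_norml => /andP[hp _]; move: p00 ap a0 hp; lra.
  exists ([set p | d p0 p < r], [set k | k.+1%:R^-1 < r]) => /=.
    split; last exact: near_inv_nat.
    by apply/metric_nbhsP; exists r.
  by move=> [p k] /= [pp0 kr] q pq; apply: rP => //; exact: lt_trans kr.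
move=> /filter_ex[k kP]; exists k.+1%:R^-1 => // p q; exact: kP.
Qed.

Lemma continuous_unif (f : cantor_fan R -> cantor_fan R) e : continuous f -> 0 < e ->
  exists2 a, 0 < a & forall p q, d p q < a -> d (f p) (f q) < e.
Proof.
move=> fc e0.
pose P k p := forall q, d p q < k.+1%:R^-1 -> d (f p) (f q) < e.
have : \forall k \near \oo, [set: cantor_fan R] `<=` P k.
  move/compact_near_coveringP : (@cantor_fan_compact R); apply => p0 _.
  have /fc/metric_nbhsP[r r0 rf] : nbhs (f p0) [set q | d (f p0) q < e / 2].
    by apply/metric_nbhsP; exists (e / 2); rewrite ?divr_gt0.
  exists ([set p | d p0 p < r / 2], [set k | k.+1%:R^-1 < r / 2]) => /=.
    split; last by apply: near_inv_nat; rewrite divr_gt0.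
    by apply/metric_nbhsP; exists (r / 2); rewrite ?divr_gt0.
  move=> [p k] /= [pp0 kr] q pq.
  have := cmetric_triangle dC (f p0) (f p) (f q); rewrite (cmetric_sym dC (f p) (f p0)).
  have /= := rf p; have /= := rf q; have := cmetric_triangle dC p p0 q.
  move=> tr fq fp; move=> /le_lt_trans; apply; rewrite [ltRHS]splitr ltrD//.
    by apply: fp; move: pp0 r0; lra.
  by apply: fq; move: pp0 (lt_trans pq kr) tr; lra.
move=> /filter_ex[k kP]; exists k.+1%:R^-1 => // p q; exact: kP.
Qed.

End fan_metric.

(** * Homeomorphisms of the fan *)

Section fan_homeo.
Context (R : realType) (d : cantor_fan R -> cantor_fan R -> R).
Context (dC : compatible_metric d).
Implicit Types (x y : cantor_space) (s t : R) (p q : cantor_fan R).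

(** Off the apex each bit of the blade is locally constant, hence constant along a path parametrized
    by an interval. *)
Lemma path_blade (F : R -> cantor_fan R) a b : a <= b -> continuous F ->
  (forall t, a <= t <= b -> 0 < height (F t)) -> blade (F a) = blade (F b).
Proof.
move=> ab Fc F0; apply: funext => i.
pose C c := [set t | 0 < height (F t) /\ blade (F t) i = c].
have Co c : open (C c).
  rewrite openE => t [t0 tc].
  have h : nbhs (F t) ([set q | agree i.+1 (blade (F t)) (blade q)] `&` [set q | 0 < height q]).
    apply: filterI; first exact: blade_near.
    exact: (@continuous_height R (F t) _ (lt_nbhsr t0)).
  have h2 : nbhs t (F @^-1` _) := Fc t _ h.
  apply: filterS h2 => s [/= ts s0]; split => //.
  by rewrite -tc ts.
have : `[a, b]%classic `&` C (blade (F a) i) = `[a, b]%classic.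
  apply: (@segment_connected R a b).
  - exists a; split => /=; first by rewrite in_itv/= lexx.
    by split => //; apply: F0; rewrite lexx.
  - by exists (C (blade (F a) i)).
  - exists (~` C (~~ blade (F a) i)); first exact: open_closedC.
    apply/seteqP; split => t [tab]; rewrite /C/=.
      by move=> [t0 ->]; split => // -[_]; case: (blade (F a) i).
    move=> nC; split => //; have t0 : 0 < height (F t) by apply: F0; move: tab; rewrite /= in_itv.
    split=> //; move: nC.
    by case: (blade (F t) i); case: (blade (F a) i) => // nC; case: nC.
move=> /seteqP[_ /(_ b)]; rewrite /= in_itv/= ab lexx => /(_ isT)[_ [_ ->//]].
Qed.

Section homeo.
Variables f g : cantor_fan R -> cantor_fan R.
Hypotheses (fc : continuous f) (fK : cancel f g).

Lemma continuous_ray x : continuous (fun t => f (fan_pt x t)).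
Proof.
move=> t; apply: (@continuous_comp _ _ _ (fan_pt x) f); last exact: fc.
apply: (@continuous_comp _ _ _ (fun t => (x, t)) (fun z => fan_pt z.1 z.2)).
  by apply: (@cvg_pair _ _ _ _ (nbhs x) (nbhs t)); [exact: cvg_cst|exact: cvg_id].
exact: continuous_fan_pt.
Qed.

(* Otherwise a neighbourhood of the apex is mapped into a single blade; three
   short rays are then mapped onto three intervals with a common endpoint, two of
   which overlap. *)
Lemma homeo_apex : f (apex R) = apex R.
Proof.
apply: height_eq0; apply/eqP; rewrite eq_le height_ge0 andbT leNgt; apply/negP => tau0.
have [r r0 rf] : exists2 r, 0 < r & forall q, d (apex R) q < r -> 0 < height (f q).
  apply/(metric_nbhsP dC).
  have h : nbhs (f (apex R)) [set q | 0 < height q].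
    exact: (@continuous_height R _ _ (lt_nbhsr tau0)).
  exact: (fc h).
have [a a0 ar] := apex_unif dC r0.
pose u := Num.min (a / 2) 1.
have u0 : 0 < u by rewrite lt_min ltr01 divr_gt0.
have u1 : u <= 1 by rewrite ge_min lexx orbT.
have ua : u < a by rewrite gt_min; apply/orP; left; move: a0; lra.
have tu1 t : 0 <= t <= u -> 0 <= t <= 1.
  by move=> /andP[-> /le_trans]; apply.
have hpos x t : 0 <= t <= u -> 0 < height (f (fan_pt x t)).
  move=> tu; apply: rf; rewrite (cmetric_sym dC); apply: ar.
  have [-> _] := fan_ptP x (tu1 t tu).
  by move: tu => /andP[_ /le_lt_trans]; apply.
(* Short rays are mapped off the apex, so their images remain in the blade of the image of the
   apex. *)
have same x t : 0 <= t <= u -> blade (f (fan_pt x t)) = blade (f (apex R)).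
  move=> /andP[t0 tu]; rewrite /apex (fan_pt0 _ point x); apply/esym.
  apply: (@path_blade _ _ _ t0 (@continuous_ray x)) => s /andP[s0 st].
  by apply: hpos; rewrite s0 (le_trans st).
pose h x t := height (f (fan_pt x t)).
have h_inj x y t : 0 <= t <= u -> h x u = h y t -> x = y.
  move=> tu hxy.
  have uu : 0 <= u <= u by rewrite lexx ltW.
  have fxy : f (fan_pt x u) = f (fan_pt y t).
    rewrite -[LHS]fan_ptK -[RHS]fan_ptK; congr fan_pt => //.
    by rewrite !same.
  have xy : fan_pt x u = fan_pt y t by rewrite -[LHS]fK fxy fK.
  have [hx bx] := fan_ptP x (tu1 u uu); have [hy by'] := fan_ptP y (tu1 t tu).
  have tE : t = u by rewrite -hx -hy xy.
  by rewrite -bx// -by' ?tE// xy tE.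
have h0 x : h x 0 = height (f (apex R)) by rewrite /h /apex (fan_pt0 _ point x).
pose tau := height (f (apex R)).
(* A height between the ends of the image of the ray [y] is attained on that ray, and injectivity of
   [f] forces the two rays to coincide. *)
have between x y : x <> y -> Num.min tau (h y u) <= h x u <= Num.max tau (h y u) -> False.
  move=> xy; rewrite /tau -(h0 y) => hxy; apply: xy.
  have [|t] := @IVT R (h y) 0 u (h x u) (ltW u0) _ hxy.
    apply: continuous_subspaceT => t.
    apply: (@continuous_comp _ _ _ (fun t => f (fan_pt y t)) (@height R)).
      exact: continuous_ray.
    exact: continuous_height.
  by rewrite in_itv /= => tu hyt; apply: (h_inj _ _ t).
(* Of three end heights two lie on the same side of [tau], and the one nearer to [tau] contradicts
   [between]. *)
pose x : cantor_space := fun=> false.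
pose y : cantor_space := fun=> true.
pose z : cantor_space := fun n => n == 0%N.
have xy : x <> y by move=> /(congr1 (fun w : cantor_space => w 0%N)).
have xz : x <> z by move=> /(congr1 (fun w : cantor_space => w 0%N)).
have yz : y <> z by move=> /(congr1 (fun w : cantor_space => w 1%N)).
have ne v w : v <> w -> ~~ ((tau <= h v u) && (h v u <= h w u) || (h w u <= h v u) && (h v u <= tau)).
  move=> vw; apply/negP => H; apply: (between v w vw).
  by move: H; rewrite ge_min le_max => /orP[/andP[->->]|/andP[-> ->]]; rewrite ?orbT.
have [yx zx zy] : [/\ y <> x, z <> x & z <> y] by split; apply: nesym.
have := ne _ _ xy; have := ne _ _ yx; have := ne _ _ xz; have := ne _ _ zx.
have := ne _ _ yz; have := ne _ _ zy.
by lra.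
Qed.

Lemma homeo_height_gt0 p : 0 < height p -> 0 < height (f p).
Proof.
move=> p0; rewrite lt_neqAle height_ge0 andbT; apply/negP => /eqP/esym/height_eq0.
rewrite -homeo_apex => /(can_inj fK) pE.
by move: p0; rewrite pE height_apex ltxx.
Qed.

Definition blade_map x := blade (f (fan_pt x 1)).

(** The segment from [p] to the top of its blade avoids the apex, and so does its image, since [f]
    fixes the apex. *)
Lemma blade_homeo p : 0 < height p -> blade (f p) = blade_map (blade p).
Proof.
move=> p0; rewrite /blade_map -{1}[p]fan_ptK.
apply: (@path_blade _ _ _ (height_le1 p) (@continuous_ray _)) => t /andP[pt t1].
apply: homeo_height_gt0; have [|-> _] := @fan_ptP R (blade p) t; last exact: lt_le_trans pt.
by rewrite t1 (le_trans (height_ge0 p)).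
Qed.

Lemma homeo_height_small b : 0 < b ->
  exists2 a, 0 < a & forall p, height p < a -> height (f p) < b.
Proof.
move=> b0; have [e e0 eP] := height_unif dC 0 b0.
have [r r0 rP] := continuous_unif dC fc e0.
have [a a0 aP] := apex_unif dC r0.
exists a => // p /aP/rP; rewrite homeo_apex => /eP[+ _].
by rewrite height_apex subr0 ger0_norm// height_ge0.
Qed.

End homeo.

Section blade_map.
Variables f g : cantor_fan R -> cantor_fan R.
Hypotheses (fc : continuous f) (gc : continuous g) (fK : cancel f g) (gK : cancel g f).

Lemma blade_mapK : cancel (blade_map f) (blade_map g).
Proof.
move=> x; have [] := @fan_ptP R x 1; first by rewrite ler01 lexx.
move=> h1 b1; rewrite -(blade_homeo gc gK) ?fK ?b1//.
by apply: (homeo_height_gt0 fc fK); rewrite h1.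
Qed.

(** Nearby tops have nearby images, which determines bits of the blade only at heights bounded
    below. Such a bound holds because [g] maps points near the apex to heights below 1, never to
    tops. *)
Lemma blade_map_unif n : exists m, forall x y, agree m x y ->
  agree n (blade_map f x) (blade_map f y).
Proof.
have [a a0 aP] := homeo_height_small gc gK ltr01.
have [e e0 eP] := height_unif dC n a0.
have [r r0 rP] := continuous_unif dC fc e0.
have [m mP] := fan_pt_unif dC r0.
exists m => x y xy.
have /rP/eP[_] : d (fan_pt x 1) (fan_pt y 1) < r.
  by apply: mP; rewrite ?subrr ?normr0// ler01 lexx.
apply; rewrite leNgt; apply/negP => /aP; rewrite fK.
by have [|-> _] := @fan_ptP R x 1; rewrite ?ltxx ?ler01 ?lexx.
Qed.

End blade_map.

End fan_homeo.

(** * Contracting the Cantor set *)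

Section cantor_contraction.
Local Open Scope nat_scope.
Implicit Types (x y z v : cantor_space).

Definition zeros : cantor_space := fun=> false.
Definition ones : cantor_space := fun=> true.

(* [0z -> 00z], [10z -> 01z], [11z -> 1z] *)
Definition shrink z : cantor_space := fun i =>
  if z 0 then
    if z 1 then z i.+1 else if i is i'.+1 then if i' is 0 then true else z i else false
  else if i is i'.+1 then z i' else false.

Definition flip_bits z : cantor_space := fun i => ~~ z i.

Lemma flip_bitsK : involutive flip_bits.
Proof. by move=> z; apply/funext => i; rewrite /flip_bits negbK. Qed.

(** The inverse sends 00z to 0z, 01z to 10z and 1z to 11z, which is [shrink] with the roles of the
    bits exchanged. *)
Definition unshrink z := flip_bits (shrink (flip_bits z)).

Lemma shrinkK : cancel shrink unshrink.
Proof.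
move=> z; apply/funext => -[|[|[|i]]]; rewrite /unshrink /flip_bits /shrink /=;
  by case z0: (z 0); case z1: (z 1); rewrite /= ?negbK ?z0 ?z1 //=;
     case z2: (z 2); rewrite /= ?negbK ?z0 ?z1 ?z2.
Qed.

Lemma unshrinkK : cancel unshrink shrink.
Proof.
move=> z; have := congr1 flip_bits (shrinkK (flip_bits z)).
by rewrite /unshrink !flip_bitsK.
Qed.

Lemma shrink_agree n z z' : agree n.+2 z z' -> agree n.+1 (shrink z) (shrink z').
Proof.
move=> zz' i iln; rewrite /shrink !(zz' 0, zz' 1)//.
by case: (z' 0); case: (z' 1) => //; move: i iln => [|[|i]] iln; rewrite ?zz'//; lia.
Qed.

Lemma iter_shrink_agree n m z z' : agree (n + m).+1 z z' ->
  agree n.+1 (iter m shrink z) (iter m shrink z').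
Proof.
elim: m n => [|m ih] n; first by rewrite addn0.
by rewrite addnS -addSn => /(ih n.+1)/shrink_agree.
Qed.

Lemma shrink_zeros n z : agree n.+1 zeros z -> agree n.+2 zeros (shrink z).
Proof.
move=> nz [|i] iln; rewrite /shrink -(nz 0)//; exact: (nz i).
Qed.

Lemma shrink_lead i z : z i.+1 = false -> exists2 j, j <= i & shrink z j = false.
Proof.
rewrite /shrink => zi; case z0: (z 0); last by exists 0.
case z1: (z 1); last by exists 0.
by case: i zi => [|i] zi; [rewrite zi in z1|exists i.+1].
Qed.

Lemma iter_shrink_zeros n m z : agree n.+1 zeros z ->
  agree (n + m).+1 zeros (iter m shrink z).
Proof.
by elim: m => [|m ih]; rewrite ?addn0// => /ih; rewrite addnS; exact: shrink_zeros.
Qed.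

(** As long as the leading bit is 1, each step brings a zero at least one place closer to the
    front. *)
Lemma iter_shrink_lead i z : z i = false ->
  exists2 k, k <= i & iter k shrink z 0 = false.
Proof.
have [n] := ubnP i; elim: n i z => // n ih [|i] z; first by exists 0.
rewrite ltnS => iln /shrink_lead[j ji /ih[|k kj zk]]; first exact: leq_ltn_trans iln.
by exists k.+1; [rewrite ltnS (leq_trans kj)|rewrite iterSr].
Qed.

(** Fewer than [m] steps bring a zero to the front, and each of the more than [m] remaining steps
    adds a leading zero. *)
Lemma iter_shrink m z : ~ agree m ones z -> agree m zeros (iter (m + m) shrink z).
Proof.
move=> nz; have [i im zi] : exists2 i, i < m & z i = false.
  apply: contra_notP nz => nz i im; apply/esym/negP => /negP zi; apply: nz.
  by exists i => //; apply/negbTE.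
have [k ki zk] := iter_shrink_lead zi.
rewrite (_ : m + m = (m + m - k) + k); last by lia.
rewrite iterD; apply: agreeW (@iter_shrink_zeros 0 (m + m - k) _ _); first by lia.
by move=> [|//] _; rewrite zk.
Qed.

Variables (k : nat) (v : cantor_space -> cantor_space).
Hypotheses (v_stem : forall x y, agree k x y -> v x = v y) (v0 : forall x, v x 0 = true).

Definition tail x : cantor_space := fun i => x (k + i).

Definition graft x z : cantor_space := fun i => if i < k then x i else z (i - k).

(* An involution exchanging [ones] and [v x] and fixing [zeros]. *)
Definition twist x z : cantor_space := fun i => if z 0 then z i == v x i else z i.

(** Each cylinder of depth [k] is preserved; on its tail [xi] acts in coordinates in which the
    prescribed tail [v x] reads [ones]. *)
Definition local_map (xi : cantor_space -> cantor_space) x :=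
  graft x (twist x (xi (twist x (tail x)))).

Lemma twistK x : involutive (twist x).
Proof.
move=> z; apply/funext => i; rewrite /twist; case z0: (z 0) => //=.
by rewrite v0 /=; case: (z i); case: (v x i).
Qed.

Lemma graft_agree x z : agree k x (graft x z).
Proof. by move=> i ik; rewrite /graft ik. Qed.

Lemma tail_graft x z : tail (graft x z) = z.
Proof. by apply/funext => i; rewrite /tail /graft ltnNge leq_addr /= addKn. Qed.

Lemma local_map_agree xi x : agree k x (local_map xi x).
Proof. exact: graft_agree. Qed.

Lemma local_mapK xi xi' : cancel xi xi' -> cancel (local_map xi) (local_map xi').
Proof.
move=> xiK x; set y := local_map xi x; have xy : agree k x y := local_map_agree xi x.
rewrite /local_map /y /local_map tail_graft.
(* The stem is unchanged, so the way back uses the same twist. *)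
have tE z : twist (graft x (twist x (xi (twist x (tail x))))) z = twist x z.
  by rewrite /twist (v_stem (agree_sym (graft_agree _ _))).
rewrite !tE twistK xiK twistK.
apply/funext => i; rewrite {1}/graft /tail; case: ltnP => ik; first by rewrite /graft ik.
by rewrite subnKC.
Qed.

Lemma local_map_unif xi : (forall n z, exists m, forall z', agree m z z' -> agree n (xi z) (xi z')) ->
  continuous (local_map xi).
Proof.
move=> xic; apply: continuous_cantorP => x n.
have [m mP] := xic n.+1 (twist x (tail x)).
have := nbhs_agree (k + m.+1 + n) x; apply: filterS => y xy i iln.
have xyk : agree k x y by apply: agreeW xy; lia.
rewrite /local_map /graft; case: ltnP => ik; first exact: xyk.
have tE z : twist y z = twist x z by rewrite /twist (v_stem xyk).
have tt' : agree m.+1 (twist x (tail x)) (twist x (tail y)).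
  by move=> j jm; rewrite /twist /tail !(xy (k + j), xy (k + 0))//; lia.
have /mP xx' := agreeW (leqnSn m) tt'.
rewrite !tE; move: (xi _) (xi _) xx' => a b ab.
by rewrite /twist !(ab (i - k), ab 0)//; lia.
Qed.

Definition attractor x := graft x zeros.
Definition repeller x := graft x (v x).

Definition cyl_contract m := local_map (iter (m + m) shrink).
Definition cyl_contract_inv m := local_map (iter (m + m) unshrink).

Lemma cyl_contractK m : cancel (cyl_contract m) (cyl_contract_inv m).
Proof.
apply: local_mapK; elim: (m + m) => // n ih z.
by rewrite iterSr [iter n.+1 shrink z]iterS shrinkK ih.
Qed.

Lemma cyl_contract_invK m : cancel (cyl_contract_inv m) (cyl_contract m).
Proof.
apply: local_mapK; elim: (m + m) => // n ih z.
by rewrite iterSr [iter n.+1 unshrink z]iterS unshrinkK ih.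
Qed.

Lemma continuous_cyl_contract m : continuous (cyl_contract m).
Proof.
apply: local_map_unif => n z; exists (n + (m + m)).+1 => z' zz'.
exact/(agreeW (leqnSn n))/iter_shrink_agree.
Qed.

(** Outside the repelling cylinder some of the first [m] twisted bits is 0, so [iter_shrink]
    applies; the twist back is the identity on sequences starting with 0. *)
Lemma cyl_contractP m x : 0 < m -> ~ agree (k + m) (repeller x) x ->
  agree (k + m) (attractor x) (cyl_contract m x).
Proof.
move=> m0 nx.
have nz : ~ agree m ones (twist x (tail x)).
  apply: contra_not nx => onz i ikm; rewrite /repeller /graft.
  case: ltnP => // ki; have im : i - k < m by lia.
  have := onz _ im; have := onz _ m0; rewrite /twist /ones.
  case t0: (tail x 0) => // _ /esym/eqP <-.
  by rewrite /tail subnKC.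
have zz := iter_shrink nz; move=> i ikm; rewrite /attractor /cyl_contract /local_map /graft.
case: ltnP => // ki; have im : i - k < m by lia.
by rewrite /twist -(zz 0)// -(zz (i - k)).
Qed.

End cantor_contraction.

(** * Contracting the unit interval *)

Section staircase.
Variables (R : realType) (N : nat) (b : nat -> R) (r l : R).
Hypotheses (N0 : (0 < N)%N) (r0 : 0 < r) (l01 : 0 < l < 1).
Hypothesis bP : forall j, (j < N)%N ->
  j%:R / N%:R < b j - r /\ b j + r < j.+1%:R / N%:R.
Implicit Types (s t : R) (j : nat).

(** Linear on the window between [b j - r] and [b j + r], where it rises from 0 to 1, and constant
    elsewhere. *)
Definition ramp j t : R := Num.max 0 (Num.min 1 ((t - b j) / (2 * r) + 1 / 2)).

Definition stairs t : R := N%:R^-1 * \sum_(j < N) ramp j t.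

(** The small linear term makes the staircase strictly increasing, hence a homeomorphism of the unit
    interval. *)
Definition smooth_stairs t : R := (1 - l) * stairs t + l * t.

Definition off_window t := forall j, (j < N)%N -> r < `|t - b j|.

(** Off the windows this is the index of the plateau above [t]. *)
Definition gap t : nat := \sum_(j < N) (b j < t)%R.

Lemma ramp_ge0 j t : 0 <= ramp j t. Proof. by rewrite le_max lexx. Qed.

Lemma ramp_le1 j t : ramp j t <= 1.
Proof. by rewrite ge_max ler01 ge_min lexx. Qed.

Lemma ramp0 j t : t <= b j - r -> ramp j t = 0.
Proof.
move=> tb; apply/max_idPl; rewrite ge_min; apply/orP; right.
rewrite -[1 / 2](@mulfK _ (2 * r)) ?mulf_neq0 ?gt_eqF//.
rewrite -mulrDl pmulr_lle0 ?invr_gt0 ?mulr_gt0//; move: tb; lra.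
Qed.

Lemma ramp1 j t : b j + r <= t -> ramp j t = 1.
Proof.
move=> tb; rewrite /ramp (min_idPl _) ?(max_idPr _)//.
rewrite -[1 / 2](@mulfK _ (2 * r)) ?mulf_neq0 ?gt_eqF//.
by rewrite -mulrDl ler_pdivlMr ?mulr_gt0//; move: tb; lra.
Qed.

Lemma le_ramp j s t : s <= t -> ramp j s <= ramp j t.
Proof.
move=> st; have h : (s - b j) / (2 * r) + 1 / 2 <= (t - b j) / (2 * r) + 1 / 2.
  by rewrite lerD2r ler_pM2r ?invr_gt0 ?mulr_gt0// lerD2r.
rewrite /ramp ge_max !le_max lexx /=; apply/orP; right.
by rewrite le_min !ge_min lexx h orbT.
Qed.

Lemma continuous_ramp j : continuous (ramp j).
Proof.
move=> t; apply: (@continuous_max R R (cst 0) (fun t => Num.min 1 ((t - b j) / (2 * r) + 1 / 2))).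
  exact: cvg_cst.
apply: (@continuous_min R R (cst 1) (fun t => (t - b j) / (2 * r) + 1 / 2)).
  exact: cvg_cst.
apply: cvgD; last exact: cvg_cst.
by apply: cvgMr_tmp; apply: cvgB; [exact: cvg_id|exact: cvg_cst].
Qed.

Lemma le_stairs s t : s <= t -> stairs s <= stairs t.
Proof.
move=> st; rewrite ler_pM2l ?invr_gt0 ?ltr0n//.
by apply: ler_sum => j _; exact: le_ramp.
Qed.

Lemma sum_below n : (n <= N)%N -> \sum_(j < N) (j < n)%:R = n%:R :> R.
Proof.
move=> nN; rewrite -natr_sum -big_mkcond/= -(big_ord_widen N (fun=> 1%N))//.
by rewrite sum_nat_const card_ord muln1.
Qed.

(** In block [j] the ramps before [j] are complete and those after [j] have not begun. *)
Lemma stairs_block j t : (j < N)%N -> j%:R / N%:R <= t <= j.+1%:R / N%:R ->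
  j%:R / N%:R <= stairs t <= j.+1%:R / N%:R.
Proof.
move=> jN /andP[jt tj]; rewrite /stairs !(mulrC _ N%:R^-1).
have mono i i' : (i <= i')%N -> i%:R / N%:R <= i'%:R / N%:R :> R.
  by move=> ii; rewrite ler_pM2r ?invr_gt0 ?ltr0n// ler_nat.
rewrite !ler_pM2l ?invr_gt0 ?ltr0n// -(sum_below (ltnW jN)) -(sum_below jN).
apply/andP; split; apply: ler_sum => i _.
  case: ltnP => ij; last exact: ramp_ge0.
  rewrite ramp1//; have [_ h] := bP (ltn_ord i).
  by rewrite (le_trans (ltW h))// (le_trans _ jt)// mono.
case: ltnP => ij; first exact: ramp_le1.
rewrite ramp0//; have [h _] := bP (ltn_ord i).
by rewrite (le_trans tj)// (le_trans _ (ltW h))// mono.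
Qed.

Lemma stairs_off_window t : off_window t -> stairs t = (gap t)%:R / N%:R.
Proof.
move=> ot; rewrite /stairs mulrC natr_sum; congr (_ * _).
apply: eq_bigr => j _; have := ot _ (ltn_ord j).
case: (ltP (b j) t) => bt.
  by rewrite gtr0_norm ?subr_gt0// => h; rewrite ramp1//; move: h; lra.
by rewrite ler0_norm ?subr_le0// => h; rewrite ramp0//; move: h; lra.
Qed.

(** A centre [b j] between [s] and [t] would put them more than [2 * r] apart. *)
Lemma gap_close s t : off_window s -> off_window t -> `|s - t| <= r -> gap s = gap t.
Proof.
move=> os ot st; apply: eq_bigr => j _; congr nat_of_bool.
have := os _ (ltn_ord j); have := ot _ (ltn_ord j); move: st r0; rewrite ler_norml !ltr_normr.
by case: (ltP (b j) s); case: (ltP (b j) t) => //; lra.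
Qed.

Lemma gap_le t : (gap t <= N)%N.
Proof.
apply: (@leq_trans (\sum_(j < N) 1)%N); first by apply: leq_sum => j _; exact: leq_b1.
by rewrite sum_nat_const card_ord muln1.
Qed.

Lemma find_block t : 0 <= t <= 1 ->
  exists2 j, (j < N)%N & j%:R / N%:R <= t <= j.+1%:R / N%:R.
Proof.
move=> /andP[t0 t1].
have : exists j, (j < N)%N && (t <= j.+1%:R / N%:R).
  by exists N.-1; rewrite !prednK// leqnn divff// pnatr_eq0 -lt0n.
move=> /ex_minnP[j /andP[jN tj] jmin]; exists j => //; rewrite tj andbT.
case: j jN tj jmin => [|j] jN tj jmin; first by rewrite mul0r.
rewrite leNgt; apply/negP => tj'; have := jmin j; rewrite (ltn_trans _ jN)//= (ltW tj').
by move=> /(_ isT); rewrite ltnn.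
Qed.

Lemma stairs_dist t : 0 <= t <= 1 -> `|stairs t - t| <= N%:R^-1.
Proof.
move=> /find_block[j jN jt]; have := stairs_block jN jt; move: jt.
have -> : j.+1%:R / N%:R = j%:R / N%:R + N%:R^-1 :> R by rewrite -natr1 mulrDl mul1r.
by move: (N%:R^-1) => i; rewrite ler_norml; lra.
Qed.

Lemma stairs_itv t : 0 <= stairs t <= 1.
Proof.
rewrite /stairs mulr_ge0 ?invr_ge0 ?sumr_ge0//=; last by move=> j _; exact: ramp_ge0.
rewrite mulrC ler_pdivrMr ?ltr0n// mul1r -(sum_below (leqnn N)).
by apply: ler_sum => j _; rewrite ltn_ord ramp_le1.
Qed.

Lemma smooth_stairs_dist t : 0 <= t <= 1 -> `|smooth_stairs t - stairs t| <= l.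
Proof.
move=> t01; have s01 := stairs_itv t; rewrite /smooth_stairs.
have -> : (1 - l) * stairs t + l * t - stairs t = l * (t - stairs t) by ring.
rewrite normrM gtr0_norm; last by case/andP: l01.
rewrite ler_piMr//; first by case/andP: l01 => /ltW.
by rewrite ler_norml; move: t01 s01; lra.
Qed.

Lemma smooth_stairs_off_window t : 0 <= t <= 1 -> off_window t ->
  `|smooth_stairs t - (gap t)%:R / N%:R| <= l.
Proof. by move=> t01 /stairs_off_window<-; exact: smooth_stairs_dist. Qed.

Lemma smooth_stairs_block j t : (j < N)%N -> 0 <= t <= 1 ->
  j%:R / N%:R <= t <= j.+1%:R / N%:R ->
  j%:R / N%:R - l <= smooth_stairs t <= j.+1%:R / N%:R + l.
Proof.
move=> jN t01 /(stairs_block jN); have := smooth_stairs_dist t01.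
move: (j%:R / N%:R) (j.+1%:R / N%:R) (stairs t) (smooth_stairs t) => a a' s s'.
by rewrite ler_norml; lra.
Qed.

Lemma smooth_stairs_id_dist t : 0 <= t <= 1 -> `|smooth_stairs t - t| <= N%:R^-1.
Proof.
move=> t01; have h := stairs_dist t01; rewrite /smooth_stairs.
have -> : (1 - l) * stairs t + l * t - t = (1 - l) * (stairs t - t) by ring.
rewrite normrM gtr0_norm; last by move: l01; lra.
by rewrite (le_trans _ h)// ler_piMl//; move: l01; lra.
Qed.

Lemma smooth_stairs_mono s t : s < t -> smooth_stairs s < smooth_stairs t.
Proof.
move=> st; rewrite /smooth_stairs ler_ltD//.
  by rewrite ler_wpM2l ?le_stairs ?ltW//; move: l01; lra.
by rewrite ltr_pM2l//; case/andP: l01.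
Qed.

Lemma smooth_stairs_inj : injective smooth_stairs.
Proof.
move=> s t; case: (ltgtP s t) => // /smooth_stairs_mono + st; rewrite st ltxx//.
Qed.

Lemma smooth_stairs0 : smooth_stairs 0 = 0.
Proof.
rewrite /smooth_stairs /stairs big1 ?mulr0 ?addr0// => j _.
rewrite ramp0//; have [/ltW h _] := bP (ltn_ord j).
by apply: le_trans h; rewrite divr_ge0.
Qed.

Lemma smooth_stairs1 : smooth_stairs 1 = 1.
Proof.
rewrite /smooth_stairs /stairs (eq_bigr (fun=> 1)) => [|j _].
  by rewrite sumr_const card_ord -[1 *+ N]/(N%:R) mulVf ?pnatr_eq0 -?lt0n//; lra.
rewrite ramp1//; have [_ /ltW h] := bP (ltn_ord j).
by apply: le_trans h _; rewrite ler_pdivrMr ?ltr0n// mul1r ler_nat.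
Qed.

Lemma smooth_stairs_itv t : 0 <= t <= 1 -> 0 <= smooth_stairs t <= 1.
Proof.
move=> /andP[t0 t1]; have mono := le_mono smooth_stairs_mono.
by have := mono t 1; have := mono 0 t; rewrite smooth_stairs0 smooth_stairs1 => -> ->; rewrite t0 t1.
Qed.

Lemma continuous_smooth_stairs : continuous smooth_stairs.
Proof.
have sc : continuous (fun t => \sum_(j < N) ramp j t).
  have -> : (fun t => \sum_(j < N) ramp j t) = \sum_(j < N) (ramp j).
    by apply/funext => s; rewrite fct_sumE.
  elim/big_ind: _ => [x|f g fc gc x|j _]; first exact: cvg_cst.
    by apply: cvgD; [exact: fc|exact: gc].
  exact: continuous_ramp.
move=> t; apply: cvgD; last by apply: cvgMl_tmp; exact: cvg_id.
by apply: cvgMl_tmp; apply: cvgMl_tmp; exact: sc.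
Qed.

Lemma smooth_stairs_surj s : 0 <= s <= 1 -> exists2 t, 0 <= t <= 1 & smooth_stairs t = s.
Proof.
move=> s01; have [||t] := @IVT R smooth_stairs 0 1 s ler01.
- exact: continuous_subspaceT continuous_smooth_stairs.
- by rewrite smooth_stairs0 smooth_stairs1 (min_idPl ler01) (max_idPr ler01).
- by rewrite in_itv /= => t01 ts; exists t.
Qed.

End staircase.

(** * Product maps of the fan *)

Lemma compatible_metric_hausdorff (R : realType) (T : topologicalType) (d : T -> T -> R) :
  compatible_metric d -> hausdorff_space T.
Proof.
move=> dT x y xy; apply: (cmetric_eq0 dT); apply/eqP.
rewrite eq_le (cmetric_ge0 dT) andbT leNgt; apply/negP => xy0.
have nb z : nbhs z [set w | d z w < d x y / 2].
  by rewrite (cmetric_nbhs dT); exists (d x y / 2) => //=; rewrite divr_gt0.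
have [z [/= xz yz]] := xy _ _ (nb x) (nb y).
have := cmetric_triangle dT z x y; rewrite (cmetric_sym dT z y).
by move: xz yz; lra.
Qed.

Lemma continuous_bij_homeo (T : topologicalType) (f : T -> T) :
  compact [set: T] -> hausdorff_space T -> continuous f -> bijective f ->
  homeomorphism f.
Proof.
move=> cT hT fc [g fK gK]; split => //; exists g; split => //.
apply/continuous_closedP => A Ac.
rewrite (_ : g @^-1` A = f @` A); last first.
  apply/seteqP; split => [y Ay|_ [x Ax <-]]; last by rewrite /= fK.
  by exists (g y).
apply: compact_closed => //; apply: continuous_compact; first exact: continuous_subspaceT.
exact: subclosed_compact Ac cT _.
Qed.

Section fan_map.
Variables (R : realType) (d : cantor_fan R -> cantor_fan R -> R).
Hypothesis dC : compatible_metric d.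
Variables (theta theta_inv : cantor_space -> cantor_space) (kap : R -> R).
Hypotheses (theta_cont : continuous theta) (thetaK : cancel theta theta_inv)
  (theta_invK : cancel theta_inv theta).
Hypotheses (kap_cont : continuous kap) (kap0 : kap 0 = 0) (kap_inj : injective kap).
Hypothesis kap_itv : forall t, 0 <= t <= 1 -> 0 <= kap t <= 1.
Hypothesis kap_surj : forall s, 0 <= s <= 1 -> exists2 t, 0 <= t <= 1 & kap t = s.

Definition fan_map (p : cantor_fan R) : cantor_fan R :=
  fan_pt (theta (blade p)) (kap (height p)).

Lemma height_fan_map p : height (fan_map p) = kap (height p).
Proof. by have [] := fan_ptP (theta (blade p)) (kap_itv (height_itv p)). Qed.

Lemma kap_eq0 t : kap t = 0 -> t = 0.
Proof. by move=> t0; apply: kap_inj; rewrite t0. Qed.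

Lemma blade_fan_map p : 0 < height p -> blade (fan_map p) = theta (blade p).
Proof.
move=> p0; have kp := kap_itv (height_itv p).
have [_ ->//] := fan_ptP (theta (blade p)) kp.
rewrite lt_neqAle (andP kp).1 andbT; apply/negP => /eqP/esym/kap_eq0 p00.
by rewrite p00 ltxx in p0.
Qed.

(** At height 0 the chosen representative may lie on another blade, but [kap] fixes 0 and both sides
    are the apex. *)
Lemma fan_map_pt x t : 0 <= t <= 1 -> fan_map (fan_pt x t) = fan_pt (theta x) (kap t).
Proof.
move=> t01; have [ht bt] := fan_ptP x t01; rewrite /fan_map ht.
have [/bt->//|t0] := ltP 0 t.
have -> : t = 0 by apply/eqP; rewrite eq_le t0; case/andP: t01.
by rewrite kap0; exact: fan_pt0.
Qed.

Lemma continuous_fan_map : continuous fan_map.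
Proof.
apply: continuous_fan.
have -> : (fun z : cantor_space * unit_interval R => fan_map (\pi_(cantor_fan R)%qT z)) =
    (fun z : cantor_space * R => fan_pt z.1 z.2) \o (fun z => (theta z.1, kap (set_val z.2))).
  apply/funext => -[x t] /=; rewrite set_valE.
  have t01 : 0 <= val t <= 1 by have := set_mem (valP t); rewrite /= in_itv.
  rewrite -fan_map_pt//; congr fan_map.
  by congr (\pi_(_)%qT (_, _)); apply/val_inj; rewrite clamp_id.
move=> z; apply: continuous_comp; last exact: continuous_fan_pt.
apply: (@cvg_pair _ _ _ _ (nbhs (theta z.1)) (nbhs (kap (set_val z.2)))).
  by apply: (@continuous_comp _ _ _ fst theta); [exact: cvg_fst|exact: theta_cont].
apply: (@continuous_comp _ _ _ (fun z => set_val z.2) kap); last exact: kap_cont.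
apply: (@continuous_comp _ _ _ snd (set_val : unit_interval R -> R)); first exact: cvg_snd.
exact: initial_continuous.
Qed.

Lemma fan_map_homeo : homeomorphism fan_map.
Proof.
apply: continuous_bij_homeo.
- exact: cantor_fan_compact.
- exact: compatible_metric_hausdorff dC.
- exact: continuous_fan_map.
have inj : injective fan_map.
  move=> p q pq.
  have hpq : height p = height q by apply: kap_inj; rewrite -!height_fan_map pq.
  have [p0|p0] := ltP 0 (height p).
    have q0 : 0 < height q by rewrite -hpq.
    have bpq : blade p = blade q.
      by rewrite -(thetaK (blade p)) -(thetaK (blade q)) -!blade_fan_map// pq.
    by rewrite -[p]fan_ptK -[q]fan_ptK hpq bpq.
  have p00 : height p = 0 by apply/eqP; rewrite eq_le p0 height_ge0.
  by rewrite (height_eq0 p00) (height_eq0 (etrans (esym hpq) p00)).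
have surj q : exists p, fan_map p = q.
  have [t t01 tq] := kap_surj (height_itv q).
  exists (fan_pt (theta_inv (blade q)) t).
  by rewrite fan_map_pt// theta_invK tq fan_ptK.
have [g gP] := choice surj.
by exists g => // p; apply: inj; rewrite gP.
Qed.

End fan_map.

(** * Forward and backward determinism *)

Lemma avoid_finite (X : Type) (I : finType) (F : I -> X) (G : nat -> X) :
  injective G -> exists n, forall i, G n <> F i.
Proof.
move=> Ginj; apply: contrapT => none.
have hit n : exists i, G n = F i.
  by apply: contrapT => h; apply: none; exists n => i ni; apply: h; exists i.
have [h hP] := choice hit.
have hinj : injective (fun n : 'I_#|I|.+1 => h n).
  by move=> n n' nn'; apply/val_inj/Ginj; rewrite !hP nn'.
by have := leq_card _ hinj; rewrite card_ord ltnn.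
Qed.

Lemma finite_lower_bound (R : realDomainType) (I : finType) (F : I -> R) :
  (forall i, 0 < F i) -> exists2 r, 0 < r & forall i, r <= F i.
Proof.
move=> F0; exists (\big[Num.min/1]_i F i).
  by elim/big_ind: _ => // x y x0 y0; rewrite lt_min x0.
by move=> i; exact: bigmin_le_cond.
Qed.

Section walk.
Variables (V : Type) (S : V -> V -> Prop).

Fixpoint walk n v u := if n is n'.+1 then exists2 w, S v w & walk n' w u else v = u.

Lemma walk_add a b x y z : walk a x y -> walk b y z -> walk (a + b) x z.
Proof.
elim: a x => [|a ih] x /=; first by move=> ->.
by move=> [w xw wy] yz; exists w => //; exact: ih wy yz.
Qed.

Lemma walk_loop a n x : walk a x x -> walk (a * n) x x.
Proof.
move=> ax; elim: n => [|n ih]; first by rewrite muln0.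
by rewrite mulnS; exact: walk_add ax ih.
Qed.

Hypothesis cyclic : forall v w, S v w -> exists n, walk n w v.

(** Closing up each edge gives loops of lengths a + 1 and b + 1; running around them pads both
    returns to the length (a + 1)(b + 1) - 1. *)
Lemma common_return v w v' w' : S v w -> S v' w' ->
  exists n, walk n w v /\ walk n w' v'.
Proof.
move=> vw vw'; have [a wv] := cyclic vw; have [b wv'] := cyclic vw'.
exists (a + a.+1 * b)%N; split.
  by apply: (walk_add wv); apply: (@walk_loop a.+1); exists w.
rewrite (_ : (a + a.+1 * b = b + b.+1 * a)%N); last by lia.
by apply: (walk_add wv'); apply: (@walk_loop b.+1); exists w'.
Qed.

Variables (W : Type) (pi : V -> W).

(** Return from [w] to [v] and from [w'] to [v'] in equally many steps: the endpoints have the same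
    image under [pi], and backward determinism carries this equality back to [w] and [w']. *)
Lemma forward_of_backward :
  (forall v w v' w', S v w -> S v' w' -> pi w = pi w' -> pi v = pi v') ->
  forall v w v' w', S v w -> S v' w' -> pi v = pi v' -> pi w = pi w'.
Proof.
move=> back v w v' w' vw vw' vv'; have [n [wv wv']] := common_return vw vw'.
elim: n w w' {vw vw'} wv wv' => [|n ih] w w' /=; first by move=> -> ->.
by move=> [x wx xv] [x' wx' xv']; apply: back wx wx' (ih _ _ xv xv').
Qed.

(** The mirror image: the equality at [w] and [w'] is pushed forward along returns of equal
    length. *)
Lemma backward_of_forward :
  (forall v w v' w', S v w -> S v' w' -> pi v = pi v' -> pi w = pi w') ->
  forall v w v' w', S v w -> S v' w' -> pi w = pi w' -> pi v = pi v'.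
Proof.
move=> forw v w v' w' vw vw' ww'; have [n [wv wv']] := common_return vw vw'.
elim: n w w' ww' {vw vw'} wv wv' => [|n ih] w w' ww' /=; first by move=> <- <-.
by move=> [x wx xv] [x' wx' xv']; apply: ih xv xv'; apply: forw wx wx' ww'.
Qed.

End walk.

Section returning_walk.
Variables (J : finType) (E : rel J).

(** A path between two vertices of one strongly connected component never leaves it. *)
Lemma connect_walk v w : connect E v w -> connect E w v -> exists n, walk (returning E) n v w.
Proof.
move=> /connectP[p + ->]; elim: p v => [|x p ih] v /=; first by exists 0%N.
move=> /andP[vx xp] back.
have xl : connect E x (last x p) by apply/connectP; exists p.
have [n nw] : exists n, walk (returning E) n x (last x p).
  by apply: ih => //; apply: connect_trans back (connect1 vx).
exists n.+1, x => //; rewrite /returning vx /=; exact: connect_trans xl back.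
Qed.

Lemma returning_cyclic v w : returning E v w -> exists n, walk (returning E) n w v.
Proof. by move=> /andP[vw wv]; apply: connect_walk => //; exact: connect1. Qed.

Lemma level_connect (lev : J -> nat) : (forall v w, E v w -> (lev w <= lev v)%N) ->
  forall v w, connect E v w -> (lev w <= lev v)%N.
Proof.
move=> levE v w /connectP[p + ->]; elim: p v => //= x p ih v /andP[vx /ih].
by move=> /leq_trans; apply; exact: levE.
Qed.

End returning_walk.

(* Smallness matters only for recurrent cells: transient ones may be subdivided by
   any finite labelling. *)
Lemma coding_refine (R : realType) (T : Type) (d : T -> T -> R) (f : T -> T)
    (e delta : R) (J L : finType) (E : rel J) (c : T -> J) (lab : T -> L) (l0 : L) :
  0 < delta ->
  (forall x y, d (f x) y < delta -> E (c x) (c y)) ->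
  return_unique E ->
  (forall x y v, returning E (c x) v -> c x = c y -> d x y <= e) ->
  (forall x y, lab x = lab y -> d x y <= e) ->
  (forall x y v w, returning E (c x) v -> returning E (c y) w ->
    c x <> c y -> delta <= d x y) ->
  coded d f e.
Proof.
move=> delta0 edge uniqE small lab_small sep.
pose rec v := [exists w, returning E v w].
(* Entering a recurrent cell resets the label to [l0], so the refinement creates no branching among
   recurrent vertices. *)
pose E' : rel (J * L) := fun v w => E v.1 w.1 && (rec w.1 ==> (w.2 == l0)).
pose c' x := (c x, if rec (c x) then l0 else lab x).
have conn v w : connect E' v w -> connect E v.1 w.1.
  move=> /connectP[p + ->]; elim: p v => //= x p ih v /andP[/andP[vx _] /ih].
  exact/connect_trans/connect1.
have ret v w : returning E' v w -> returning E v.1 w.1.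
  by move=> /andP[/andP[vw _] /conn wv]; rewrite /returning vw.
have rec_ret v w : returning E v w -> rec w.
  move=> vw; have [n] := returning_cyclic vw.
  case: n => [|n] /=; first by move=> wv; rewrite wv in vw *; apply/existsP; exists v.
  by move=> [x wx _]; apply/existsP; exists x.
exists delta, (J * L)%type, E', c'; split => //.
- move=> x y xy; rewrite /E' /= edge//=; apply/implyP => ry; rewrite ry; exact: eqxx.
- move=> v w w' vw vw'; have e1 := uniqE _ _ _ (ret _ _ vw) (ret _ _ vw').
  have := vw; have := vw'; move=> /andP[/andP[_ l'] _] /andP[/andP[_ l] _].
  have /implyP/(_ (rec_ret _ _ (ret _ _ vw)))/eqP lw := l.
  have /implyP/(_ (rec_ret _ _ (ret _ _ vw')))/eqP lw' := l'.
  by rewrite [w]surjective_pairing [w']surjective_pairing e1 lw lw'.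
- move=> x y [cxy]; rewrite -cxy; case: ifPn => [/existsP[v xv] _|_].
    exact: small xv cxy.
  exact: lab_small.
- move=> x y v w /ret xv /ret yw nc.
  have rx : rec (c x) by apply/existsP; exists v.1.
  have ry : rec (c y) by apply/existsP; exists w.1.
  by apply: sep xv yw _ => cxy; apply: nc; rewrite /c' rx ry cxy.
Qed.

(* [None] is the cell of the apex; [Some (b, c)] is a product cell with base
   component [b] and fibre component [c], where [None] means transient, [(_, true)]
   attracting and [(_, false)] repelling. *)
Definition cell (W I : Type) : Type := option (option (W * bool) * option (I * bool)).

Section cell_graph.
Local Open Scope nat_scope.
Variables (W I : finType) (E : rel (cell W I)).
Implicit Types (u v w : cell W I) (D : W * bool).

(** Orbits pass from repelling through transient to attracting, never in the other direction. *)
Definition kind_level (X : Type) (a : option (X * bool)) : nat :=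
  match a with Some (_, true) => 0 | None => 1 | Some (_, false) => 2 end.

(** Lexicographic order, base first: the fibre may become repelling again when the base kind drops.
    The absorbing apex cell is lowest, and the base-3 digits determine the kind. *)
Definition level v : nat :=
  if v is Some (b, c) then (3 * kind_level b + kind_level c).+1 else 0.

Definition transient v : Prop :=
  if v is Some (b, c) then b = None \/ c = None else False.

Definition kind v : option (option bool * option bool) :=
  omap (fun bc => (omap snd bc.1, omap snd bc.2)) v.

Definition base_of v : option W := obind (fun bc => omap fst bc.1) v.

Hypothesis E_apex : forall w, E None w -> w = None.
Hypothesis E_level : forall v w, E v w -> level w <= level v.
Hypothesis E_transient : forall v w, E v w -> transient v -> level w < level v.
Hypothesis attracting_base : forall (a a' b b' : W) s s' t t',
  E (Some (Some (a, true), s)) (Some (Some (b, true), t)) ->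
  E (Some (Some (a', true), s')) (Some (Some (b', true), t')) -> a = a' -> b = b'.
Hypothesis repelling_base : forall (a a' b b' : W) s s' t t',
  E (Some (Some (a, false), s)) (Some (Some (b, false), t)) ->
  E (Some (Some (a', false), s')) (Some (Some (b', false), t')) -> b = b' -> a = a'.
Hypothesis attracting_fibre : forall D D1 D2 (i i1 i2 : I),
  E (Some (Some D, Some (i, true))) (Some (Some D1, Some (i1, true))) ->
  E (Some (Some D, Some (i, true))) (Some (Some D2, Some (i2, true))) -> i1 = i2.
Hypothesis repelling_fibre : forall D D1 D2 (i i1 i2 : I),
  E (Some (Some D1, Some (i1, false))) (Some (Some D, Some (i, false))) ->
  E (Some (Some D2, Some (i2, false))) (Some (Some D, Some (i, false))) -> i1 = i2.

Lemma returning_level v w : returning E v w -> level v = level w.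
Proof.
move=> /andP[/E_level lwv wv]; apply/eqP; rewrite eqn_leq lwv andbT.
exact: level_connect E_level _ _ wv.
Qed.

Lemma returning_transient v w : returning E v w -> ~ transient v.
Proof.
move=> vw tv; have := E_transient (proj1 (andP vw)) tv.
by rewrite (returning_level vw) ltnn.
Qed.

Lemma level_kind v w : level v = level w -> kind v = kind w.
Proof.
case: v => [[[[a []]|] [[i []]|]]|]; case: w => [[[[a' []]|] [[i' []]|]]|] //=.
Qed.

Lemma kindP v s t : kind v = Some (Some s, Some t) ->
  exists a i, v = Some (Some (a, s), Some (i, t)).
Proof.
by case: v => [[[[a s']|] [[i t']|]]|] //= [<- <-]; exists a, i.
Qed.

Lemma not_transient_kind v : v <> None -> ~ transient v ->
  exists s t, kind v = Some (Some s, Some t).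
Proof.
case: v => [[[[a s]|] [[i t]|]]|] //= _; first by exists s, t.
- by case; right.
- by case; left.
- by case; left.
Qed.

(** Returning edges keep the level and thus the kind. Within one kind the base is deterministic in
    one time direction, hence in both; given the base, the fibre is deterministic forwards or
    backwards, and backward determinism is again converted into forward determinism. *)
Lemma cell_return_unique : return_unique E.
Proof.
move=> v w w' vw vw'; have Evw := proj1 (andP vw); have Evw' := proj1 (andP vw').
have [vN|v0] := pselect (v = None).
  by rewrite vN in Evw Evw'; rewrite (E_apex Evw) (E_apex Evw').
have [s [t kv]] := not_transient_kind v0 (returning_transient vw).
(* Fixing the kind makes one determinism hypothesis apply to all edges, and returns stay within
   [S]. *)
pose S x y := returning E x y /\ kind x = Some (Some s, Some t).
have Skind x y : S x y -> kind y = Some (Some s, Some t).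
  by move=> [xy <-]; apply/esym/level_kind/returning_level.
have cyc x y : S x y -> exists n, walk S n y x.
  move=> Sxy; have ky := Skind _ _ Sxy; have [n] := returning_cyclic Sxy.1; exists n.
  elim: n y {Sxy} ky p => // n ih y ky [z yz zx]; exists z => //.
  by apply: ih zx; apply: (Skind y).
have shape x y : S x y -> exists a i b j,
    [/\ x = Some (Some (a, s), Some (i, t)), y = Some (Some (b, s), Some (j, t)) & E x y].
  move=> Sxy; have [a [i xE]] := kindP Sxy.2; have [b [j yE]] := kindP (Skind _ _ Sxy).
  by exists a, i, b, j; split => //; exact: (proj1 (andP Sxy.1)).
have [Svw Svw'] : S v w /\ S v w' by [].
have [base_forw base_back] :
  (forall x y x' y', S x y -> S x' y' -> base_of x = base_of x' -> base_of y = base_of y') /\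
  (forall x y x' y', S x y -> S x' y' -> base_of y = base_of y' -> base_of x = base_of x').
  case: s {kv Skind Svw Svw'} @S cyc shape => S cyc shape.
    have forw x y x' y' : S x y -> S x' y' -> base_of x = base_of x' -> base_of y = base_of y'.
      move=> /shape[a [i [b [j [-> -> xy]]]]] /shape[a' [i' [b' [j' [-> -> xy']]]]] /= [aa'].
      by rewrite (attracting_base xy xy' aa').
    by split => //; exact: backward_of_forward.
  have back x y x' y' : S x y -> S x' y' -> base_of y = base_of y' -> base_of x = base_of x'.
    move=> /shape[a [i [b [j [-> -> xy]]]]] /shape[a' [i' [b' [j' [-> -> xy']]]]] /= [bb'].
    by rewrite (repelling_base xy xy' bb').
  by split => //; exact: forward_of_backward.
case: t {kv Skind} @S cyc shape Svw Svw' base_forw base_back => S cyc shape Svw Svw' bf bb.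
  have := bf _ _ _ _ Svw Svw' erefl.
  have [a [i [b [j [vE wE xy]]]]] := shape _ _ Svw.
  have [a' [i' [b' [j' [vE' wE' xy']]]]] := shape _ _ Svw'.
  have [ea ei] : a' = a /\ i' = i by move: vE'; rewrite vE => -[-> ->].
  rewrite wE wE' /= => -[<-]; rewrite ea ei in vE'.
  by rewrite vE wE in xy; rewrite vE' wE' in xy'; rewrite (attracting_fibre xy xy').
(* The base of the predecessor is known first, and with it the repelling fibre; whole vertices are
   thus deterministic backwards and [pi] can be the identity. *)
apply: (@forward_of_backward _ S cyc _ id _ v w v w') => // x y x' y' xy xy' yy'.
have := bb _ _ _ _ xy xy'; rewrite yy' => /(_ erefl).
have [a [i [b [j [-> yE xyE]]]]] := shape _ _ xy.
have [a' [i' [b' [j' [-> yE' xyE']]]]] := shape _ _ xy'.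
move=> /= [aa']; rewrite -aa' in xyE' *.
by rewrite yy' in xyE xyE'; rewrite yE' in xyE xyE'; rewrite (repelling_fibre xyE xyE').
Qed.

End cell_graph.

(** * The perturbed homeomorphism *)

Definition stem k (x : cantor_space) : k.-tuple bool := [tuple x i | i < k].

Definition word k (w : k.-tuple bool) : cantor_space := fun i => nth false w i.

Lemma word_stem k x i : word (stem k x) i = if (i < k)%N then x i else false.
Proof.
rewrite /word; case: ltnP => ik; last by rewrite nth_default// size_tuple.
by rewrite -[i]/(val (Ordinal ik)) -tnth_nth tnth_mktuple.
Qed.

Lemma stemP k x y : stem k x = stem k y <-> agree k x y.
Proof.
split=> [xy i ik|xy]; last by apply: eq_mktuple => i; exact: xy.
by have := congr1 (fun w => word w i) xy; rewrite /= !word_stem ik.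
Qed.

Lemma agree_word_stem k x : agree k (word (stem k x)) x.
Proof. by move=> i ik; rewrite word_stem ik. Qed.

Lemma graft_stem k x y z : agree k x y -> graft k x z = graft k y z.
Proof.
by move=> xy; apply/funext => i; rewrite /graft; case: ltnP => // /xy.
Qed.

Lemma attractor_stem k x y : agree k x y -> attractor k x = attractor k y.
Proof. exact: graft_stem. Qed.

Lemma attractor_word k x : attractor k x = word (stem k x).
Proof. by apply/funext => i; rewrite word_stem. Qed.

Section coding.
Variables (R : realType) (d : cantor_fan R -> cantor_fan R -> R).
Hypothesis dC : compatible_metric d.
Variables f g : cantor_fan R -> cantor_fan R.
Hypotheses (fc : continuous f) (gc : continuous g) (fK : cancel f g) (gK : cancel g f).

Variables (N k m M : nat) (v : cantor_space -> cantor_space) (b : nat -> R).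
Variables (r r0 l rho delta e : R) (H : k.-tuple bool * bool -> nat -> R).

Implicit Types (p q : cantor_fan R) (x y : cantor_space) (s t : R).

Let mark (i : nat) : R := i%:R / N%:R.
Let sigma := blade_map f.

(** The centre of a base cell. For a repelling cell the word names the cylinder of the image blade,
    and the centre is the preimage of the repeller of that cylinder. *)
Definition base_pt (D : k.-tuple bool * bool) : cantor_space :=
  if D.2 then word D.1 else blade_map g (repeller k v (word D.1)).

(* [H D i] stands for the height of the image of the centre of the cell [(D, i)], and
   [M], [rho] and [r] for the sizes of base cells, attracting and repelling fibre
   cells. *)
Record perturbation_data : Prop := PerturbationData {
  N_gt0 : (0 < N)%N ;
  m_gt0 : (0 < m)%N ;
  k_le_M : (k <= M)%N ;
  M_le_km : (M <= k + m)%N ;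
  v_stem : forall x y, agree k x y -> v x = v y ;
  v_head : forall x, v x 0%N = true ;
  r_gt0 : 0 < r ;
  r_le_r0 : r <= r0 ;
  l_itv : 0 < l < 1 ;
  l_le_rho : l <= rho / 4 ;
  rho_gt0 : 0 < rho ;
  rho_lt : 4 * rho < N%:R^-1 ;
  delta_gt0 : 0 < delta ;
  window_in : forall j, (j < N)%N -> mark j < b j - 4 * r0 /\ b j + 4 * r0 < mark j.+1 ;
  blade_map_close : forall x y, agree M x y -> agree k (sigma x) (sigma y) ;
  blade_map_inv_close : forall x y, agree (k + m) x y ->
    agree M (blade_map g x) (blade_map g y) ;
  attractor_avoids : forall x, agree (k + m) (attractor k x) x ->
    ~ agree (k + m) (repeller k v (sigma x)) (sigma x) ;
  fibre_image : forall p D i, (i <= N)%N -> agree M (base_pt D) (blade p) ->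
    `|height p - mark i| <= rho -> `|height (f p) - H D i| < r0 ;
  fibre_avoids : forall D i j, (i <= N)%N -> (j < N)%N -> 4 * r0 <= `|H D i - b j| ;
  apex_image : forall p, height p <= rho -> height (f p) < r0 ;
  delta_coord : forall p q, d p q < delta -> `|height p - height q| < rho / 4 /\
    (rho / 4 <= height p -> agree (k + m) (blade p) (blade q)) ;
  delta_image : forall p q, d p q < delta -> `|height (f p) - height (f q)| < r0 ;
  repelling_small : forall p q, agree M (blade p) (blade q) -> 0 < height p -> 0 < height q ->
    `|height (f p) - height (f q)| <= 2 * r -> d p q <= e /\ `|height p - height q| <= rho ;
  box_small : forall p q, agree k (blade p) (blade q) ->
    `|height p - height q| <= N%:R^-1 -> d p q <= e ;
  apex_small : forall p q, height p <= rho -> height q <= rho -> d p q <= e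
}.

Hypothesis P : perturbation_data.

Definition perturbation :=
  fan_map (cyl_contract k v m) (smooth_stairs N b r l) \o f.

(** The contraction acts after [f], so attracting cells are recognized at the blade itself and
    repelling cells at its image. *)
Definition base_code p : option (k.-tuple bool * bool) :=
  let x := blade p in let y := sigma x in
  if `[< agree (k + m) (attractor k x) x >] then Some (stem k x, true)
  else if `[< agree (k + m) (repeller k v y) y >] then Some (stem k y, false)
  else None.

(** There are N + 1 attracting levels but N windows; the shared index type explains the test
    [j < N]. *)
Definition fibre_code p : option ('I_N.+1 * bool) :=
  if [pick i : 'I_N.+1 | `|height p - mark i| <= rho] is Some i then Some (i, true)
  else if [pick j : 'I_N.+1 | (j < N)%N && (`|height (f p) - b j| <= r)] is Some j
  then Some (j, false) else None.

Definition code p : cell (k.-tuple bool) 'I_N.+1 :=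
  if height p <= rho then None
  else if base_code p is Some D then Some (Some D, fibre_code p) else Some (None, None).

Definition code_edge : rel (cell (k.-tuple bool) 'I_N.+1) := fun v w =>
  `[< exists p q, [/\ code p = v, code q = w & d (perturbation p) q < delta] >].

Lemma markS i : mark i.+1 = mark i + N%:R^-1.
Proof. by rewrite /mark -natr1 mulrDl mul1r. Qed.

Lemma mark0 : mark 0 = 0. Proof. by rewrite /mark mul0r. Qed.

Lemma N_inv_gt0 : 0 < N%:R^-1 :> R.
Proof. by rewrite invr_gt0 ltr0n (N_gt0 P). Qed.

Lemma le_mark i j : (i <= j)%N -> mark i <= mark j.
Proof. by move=> ij; rewrite ler_pM2r ?N_inv_gt0// ler_nat. Qed.

Lemma mark_ge0 i : 0 <= mark i. Proof. by rewrite -mark0 le_mark. Qed.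

Lemma mark_gap i j : (i < j)%N -> mark i + N%:R^-1 <= mark j.
Proof. by rewrite -markS; exact: le_mark. Qed.

Lemma r0_gt0 : 0 < r0. Proof. exact: lt_le_trans (r_gt0 P) (r_le_r0 P). Qed.

Lemma window_block j : (j < N)%N -> j%:R / N%:R < b j - r /\ b j + r < j.+1%:R / N%:R.
Proof.
move=> jN; have [] := window_in P jN; rewrite /mark.
by have := r_le_r0 P; have := r0_gt0; split; lra.
Qed.

Let kap := smooth_stairs N b r l.

Lemma kap_itv t : 0 <= t <= 1 -> 0 <= kap t <= 1.
Proof. exact: smooth_stairs_itv (N_gt0 P) (r_gt0 P) (l_itv P) window_block _. Qed.

Lemma kap0 : kap 0 = 0.
Proof. exact: smooth_stairs0 (r_gt0 P) window_block. Qed.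

Lemma kap_inj : injective kap.
Proof. exact: smooth_stairs_inj (N_gt0 P) (r_gt0 P) (l_itv P). Qed.

Lemma perturbation_homeo : homeomorphism perturbation.
Proof.
have [hc [h [hic hK hK']]] : homeomorphism (fan_map (cyl_contract k v m) kap).
  apply: (fan_map_homeo dC (theta_inv := cyl_contract_inv k v m)).
  - exact: continuous_cyl_contract (v_stem P) m.
  - exact: cyl_contractK (v_stem P) (v_head P) m.
  - exact: cyl_contract_invK (v_stem P) (v_head P) m.
  - exact: continuous_smooth_stairs.
  - exact: kap0.
  - exact: kap_inj.
  - exact: kap_itv.
  - exact: smooth_stairs_surj (N_gt0 P) (r_gt0 P) window_block.
split; first by move=> p; apply: continuous_comp; [exact: fc|exact: hc].
exists (g \o h); split.
- by move=> p; apply: continuous_comp; [exact: hic|exact: gc].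
- exact: can_comp hK fK.
- exact: can_comp gK hK'.
Qed.

(** The contraction keeps the first [k] bits of the blade and moves heights by at most 1/N. *)
Lemma perturbation_close p : d (f p) (perturbation p) <= e.
Proof.
have h := height_fan_map (cyl_contract k v m) kap_itv (f p).
have [fp0|fp0] := ltP 0 (height (f p)).
  apply: (box_small P).
    by rewrite /perturbation /= (blade_fan_map _ kap0 kap_inj kap_itv)//; exact: local_map_agree.
  rewrite /perturbation /= h distrC.
  exact: smooth_stairs_id_dist (N_gt0 P) (r_gt0 P) (l_itv P) window_block _ (height_itv _).
have fp00 : height (f p) = 0 by apply/eqP; rewrite eq_le fp0 height_ge0.
by apply: (apex_small P); rewrite /perturbation /= ?h ?fp00 ?kap0 ltW// (rho_gt0 P).
Qed.

(** * The cells of the coding *)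

Lemma base_codeP p :
  match base_code p with
  | Some (w, true) => w = stem k (blade p) /\ agree (k + m) (attractor k (blade p)) (blade p)
  | Some (w, false) => w = stem k (sigma (blade p)) /\
      agree (k + m) (repeller k v (sigma (blade p))) (sigma (blade p))
  | None => ~ agree (k + m) (repeller k v (sigma (blade p))) (sigma (blade p))
  end.
Proof.
rewrite /base_code; case: asboolP => // _; case: asboolP => //.
Qed.

Lemma base_code_attracting p : agree (k + m) (attractor k (blade p)) (blade p) ->
  base_code p = Some (stem k (blade p), true).
Proof. by move=> h; rewrite /base_code asboolT. Qed.

Lemma fibre_codeP p :
  match fibre_code p return Prop with
  | Some (i, true) => `|height p - mark i| <= rho
  | Some (j, false) => [/\ (j < N)%N, `|height (f p) - b j| <= r &
      forall i, (i <= N)%N -> rho < `|height p - mark i|]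
  | None => off_window N b r (height (f p))
  end.
Proof.
rewrite /fibre_code; case: pickP => [i //|nA]; case: pickP => [j /andP[jN jr]|nB].
  split=> // i iN; have := nA (inord i); rewrite inordK ?ltnS// => /negbT.
  by rewrite -ltNge.
move=> j jN; have := nB (inord j); rewrite inordK ?jN/=; last by rewrite ltnS ltnW.
by move=> /negbT; rewrite -ltNge.
Qed.

(** Levels are more than [4 * rho] apart. The laxer second bound serves a point merely close to one
    in the cell of level [j]. *)
Lemma mark_unique t i j : `|t - mark i| <= rho -> `|t - mark j| <= 2 * rho -> i = j.
Proof.
rewrite !ler_norml => ti tj; have rN := rho_lt P.
by case: (ltngtP i j) => // /mark_gap h; exfalso; move: ti tj rN h; lra.
Qed.

Lemma fibre_code_attracting p (i : 'I_N.+1) : `|height p - mark i| <= rho ->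
  fibre_code p = Some (i, true).
Proof.
move=> pi; rewrite /fibre_code; case: pickP => [j pj|/(_ i)]; last by rewrite pi.
congr (Some (_, _)); apply/val_inj/(mark_unique pj); apply: le_trans pi _.
by have := rho_gt0 P; lra.
Qed.

Lemma codeP p D a : code p = Some (Some D, a) ->
  [/\ rho < height p, base_code p = Some D & fibre_code p = a].
Proof.
by rewrite /code; case: ltP => // hp; case: (base_code p) => // D' [-> ->].
Qed.

Lemma base_code_near p D : base_code p = Some D -> agree M (base_pt D) (blade p).
Proof.
have := base_codeP p; case: (base_code p) => // -[w []] [wE ag] [<-]; rewrite /base_pt /= wE.
  by rewrite -attractor_word; exact: agreeW (M_le_km P) ag.
rewrite (_ : repeller k v _ = repeller k v (sigma (blade p))).
  by have := blade_map_inv_close P ag; rewrite /sigma (blade_mapK dC fc gc fK gK).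
rewrite /repeller (v_stem P (agree_word_stem _)).
exact: graft_stem (@agree_word_stem _ _).
Qed.

Lemma off_windowW s t : s <= t -> off_window N b t `<=` off_window N b s.
Proof. by move=> st h ht j /ht; exact: le_lt_trans. Qed.

(** The image height is within [r0] of [H D i], which keeps distance [4 * r0] from every window
    centre. *)
Lemma attracting_off_window p D (i : 'I_N.+1) : base_code p = Some D ->
  fibre_code p = Some (i, true) -> off_window N b (2 * r0) (height (f p)).
Proof.
move=> /base_code_near pD; have := fibre_codeP p; move=> /[swap] -> pi j jN.
have iN : (i <= N)%N by rewrite -ltnS.
have := fibre_image P iN pD pi; have := fibre_avoids P D iN jN.
have := ler_distD (height (f p)) (H D i) (b j); rewrite (distrC (H D i) (height _)).
by have := r0_gt0; lra.
Qed.

Lemma apex_off_window p : height p <= rho ->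
  off_window N b r (height (f p)) /\ gap N b (height (f p)) = 0%N.
Proof.
move=> /(apex_image P) hp; have r00 := r0_gt0; have rr0 := r_le_r0 P.
have bj j : (j < N)%N -> 4 * r0 < b j.
  by move=> /(window_in P)[+ _]; have := mark_ge0 j; lra.
split=> [j /bj|]; first by rewrite ltr_normr => h; apply/orP; right; lra.
apply: big1 => j _; apply/eqP; rewrite eqb0 -leNgt.
by have := bj _ (ltn_ord j); lra.
Qed.

(** * One step of a pseudo-orbit ending above the apex cell *)

Section edge.
Variables p q : cantor_fan R.
Hypotheses (pq : d (perturbation p) q < delta) (q_gt : rho < height q).

Lemma edge_coord : [/\ 0 < height p, `|kap (height (f p)) - height q| < rho / 4 &
  agree (k + m) (cyl_contract k v m (sigma (blade p))) (blade q)].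
Proof.
have := delta_coord P pq.
rewrite /perturbation /= (height_fan_map _ kap_itv) -/kap => -[kq bq].
have rho0 := rho_gt0 P.
have kp : rho / 4 <= kap (height (f p)).
  by move: kq; rewrite ltr_norml => /andP[]; move: q_gt; lra.
have fp0 : 0 < height (f p).
  rewrite lt_neqAle height_ge0 andbT; apply/negP => /eqP fp0.
  by move: kp; rewrite -fp0 kap0; lra.
have p0 : 0 < height p.
  rewrite lt_neqAle height_ge0 andbT; apply/negP => /eqP/esym/height_eq0 pa.
  by move: fp0; rewrite pa (homeo_apex dC fc fK) height_apex ltxx.
split => //; have := bq kp; rewrite (blade_fan_map _ kap0 kap_inj kap_itv)//.
by rewrite (blade_homeo dC fc fK).
Qed.

Lemma edge_stem : stem k (blade q) = stem k (sigma (blade p)).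
Proof.
have [_ _ ag] := edge_coord; apply/stemP/agree_sym.
exact: agree_trans (@local_map_agree _ _ _ _) (agreeW (leq_addr _ _) ag).
Qed.

(** The staircase is within [l <= rho / 4] of the level given by [gap], and the error of the step
    adds less than [rho / 4]. *)
Lemma edge_off_window : off_window N b r (height (f p)) ->
  fibre_code q = Some (inord (gap N b (height (f p))), true).
Proof.
move=> off; apply: fibre_code_attracting; rewrite inordK ?ltnS ?gap_le//.
have := smooth_stairs_off_window (N_gt0 P) (r_gt0 P) (l_itv P) (height_itv _) off.
have [_ + _] := edge_coord; rewrite -/kap -/(mark _).
have := l_le_rho P; have := ler_distD (kap (height (f p))) (height q) (mark (gap N b (height (f p)))).
by rewrite (distrC (height q) (kap _)); have := rho_gt0 P; lra.
Qed.

Lemma edge_attracting : ~ agree (k + m) (repeller k v (sigma (blade p))) (sigma (blade p)) ->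
  base_code q = Some (stem k (sigma (blade p)), true).
Proof.
move=> /(cyl_contractP (m_gt0 P)) ag; have [_ _ ag'] := edge_coord.
rewrite -edge_stem; apply: base_code_attracting.
rewrite (attractor_stem ((stemP _ _ _).1 edge_stem)).
exact: agree_trans ag ag'.
Qed.

(** Images of the apex cell lie below all windows and are attracted to level 0, that is, back into
    the apex cell. *)
Lemma edge_not_apex : rho < height p.
Proof.
rewrite ltNge; apply/negP => /apex_off_window[off gap0].
have := edge_off_window off; have := fibre_codeP q => /[swap] ->.
rewrite gap0 inordK// mark0 subr0 ger0_norm ?height_ge0//.
by rewrite leNgt q_gt.
Qed.

(* Between two neighbouring attracting levels lies exactly one window. *)
Lemma edge_repelling (j : nat) : (j < N)%N -> `|height (f p) - b j| <= r ->
  (forall i, (i <= N)%N -> rho < `|height q - mark i|) ->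
  mark j + rho < height q < mark j.+1 - rho.
Proof.
move=> jN pj far; have [_ + _] := edge_coord.
have [wl wr] := window_block jN.
have := @smooth_stairs_block _ _ b r l (N_gt0 P) (r_gt0 P) (l_itv P) window_block
  j (height (f p)) jN (height_itv _).
rewrite -/kap -/(mark j) -/(mark j.+1) => h.
have /h : mark j <= height (f p) <= mark j.+1.
  by move: pj wl wr; rewrite ler_norml /mark; lra.
have := far _ jN; have := far _ (ltnW jN); have := l_le_rho P; have := rho_gt0 P.
have := rho_lt P; rewrite markS.
rewrite !ltr_normr ltr_norml; lra.
Qed.

End edge.

(** * Levels and determinism in the cell graph *)

Lemma code_edge_self p q : d (perturbation p) q < delta -> code_edge (code p) (code q).
Proof. by move=> pq; apply/asboolP; exists p, q. Qed.

Lemma code_edgeP u w : code_edge u w ->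
  exists p q, [/\ code p = u, code q = w & d (perturbation p) q < delta].
Proof. by move/asboolP. Qed.

Lemma code_apex p : height p <= rho -> code p = None.
Proof. by rewrite /code => ->. Qed.

Lemma code_above p : rho < height p ->
  code p = if base_code p is Some D then Some (Some D, fibre_code p) else Some (None, None).
Proof. by rewrite /code leNgt => ->. Qed.

Lemma code_edge_apex w : code_edge None w -> w = None.
Proof.
move=> /code_edgeP[p [q [cp <- pq]]]; apply: code_apex; rewrite leNgt; apply/negP => q0.
have := code_above (edge_not_apex pq q0); rewrite cp.
by case: (base_code p).
Qed.

Lemma r_off_window p D i : base_code p = Some D -> fibre_code p = Some (i, true) ->
  off_window N b r (height (f p)).
Proof.
move=> pD pi; apply: off_windowW (attracting_off_window pD pi).
by have := r_le_r0 P; have := r0_gt0; lra.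
Qed.

(** Attracting centres avoid the repelling ones, so an attracting component stays attracting; a
    transient one becomes attracting. If a repelling base drops, the lexicographic order makes the
    fibre irrelevant. *)
Lemma code_edge_level u w : code_edge u w ->
  (level w <= level u)%N /\ (transient u -> (level w < level u)%N).
Proof.
move=> /code_edgeP[p [q [<- <- pq]]].
have [q0|q0] := leP (height q) rho.
  by rewrite (code_apex q0); split => //; case: (code p) => [[? ?] //|[]].
rewrite (code_above q0) (code_above (edge_not_apex pq q0)).
have bp := base_codeP p; have fp := fibre_codeP p.
have off D i : base_code p = Some D -> fibre_code p = Some (i, true) ->
    exists j, fibre_code q = Some (j, true).
  by move=> pD pi; eexists; exact: edge_off_window pq q0 (r_off_window pD pi).
have gapq : fibre_code p = None -> exists j, fibre_code q = Some (j, true).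
  by move=> pN; rewrite pN in fp; eexists; exact: edge_off_window pq q0 fp.
have attr : ~ agree (k + m) (repeller k v (sigma (blade p))) (sigma (blade p)) ->
    exists w, base_code q = Some (w, true).
  by move=> h; eexists; exact: edge_attracting pq q0 h.
case bpE: (base_code p) bp off => [[w1 []]|] bp off.
- have [w' ->] := attr (attractor_avoids P bp.2).
  case fpE: (fibre_code p) off gapq => [[i []]|] off gapq.
  + by have [j ->] := off _ _ erefl erefl; split => // -[].
  + by split=> [|[]//]; rewrite /level /=; case: (fibre_code q) => [[? []]|].
  + by have [j ->] := gapq erefl.
- case: (base_code q) => [[w' []]|] /=.
  + by case: (fibre_code q) => [[? []]|]; case: (fibre_code p) => [[? []]|].
  + case fpE: (fibre_code p) off gapq => [[i []]|] off gapq.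
    * by have [j ->] := off _ _ erefl erefl; split => // -[].
    * by split=> [|[]//]; case: (fibre_code q) => [[? []]|].
    * by have [j ->] := gapq erefl.
  + by case: (fibre_code p) => [[? []]|].
- have [w' ->] := attr bp.
  by case: (fibre_code q) => [[? []]|].
Qed.

Lemma code_edge_base u1 D1 a1 : code_edge u1 (Some (Some D1, a1)) ->
  exists p q, [/\ code p = u1, d (perturbation p) q < delta, rho < height q,
    rho < height p & base_code q = Some D1 /\ fibre_code q = a1].
Proof.
move=> /code_edgeP[p [q [pu /codeP[q0 bq fq] pq]]]; exists p, q; split => //.
exact: edge_not_apex pq q0.
Qed.

(** Blades of one attracting cell agree to depth [M], so their images share the stem, which the
    contraction preserves. *)
Lemma code_attracting_base (a a' c c' : k.-tuple bool) i i' j j' :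
  code_edge (Some (Some (a, true), i)) (Some (Some (c, true), j)) ->
  code_edge (Some (Some (a', true), i')) (Some (Some (c', true), j')) -> a = a' -> c = c'.
Proof.
move=> /code_edge_base[p [q [/codeP[p0 bp _] pq q0 _ [bq _]]]].
move=> /code_edge_base[p' [q' [/codeP[p0' bp' _] pq' q0' _ [bq' _]]]] aa'.
have near p1 q1 : base_code p1 = Some (a, true) -> base_code q1 = Some (a, true) ->
    agree M (blade p1) (blade q1).
  by move=> /base_code_near hx /base_code_near hy; apply: agree_trans (agree_sym hx) hy.
rewrite -aa' in bp'; have := blade_map_close P (near _ _ bp bp').
have := base_codeP q; rewrite bq => -[-> _]; have := base_codeP q'; rewrite bq' => -[-> _].
by move=> /stemP; rewrite (edge_stem pq q0) (edge_stem pq' q0').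
Qed.

(** The word of a repelling cell is the stem of the image blade, hence of the next blade. *)
Lemma code_repelling_base (a a' c c' : k.-tuple bool) i i' j j' :
  code_edge (Some (Some (a, false), i)) (Some (Some (c, false), j)) ->
  code_edge (Some (Some (a', false), i')) (Some (Some (c', false), j')) -> c = c' -> a = a'.
Proof.
move=> /code_edge_base[p [q [/codeP[p0 bp _] pq q0 _ [bq _]]]].
move=> /code_edge_base[p' [q' [/codeP[p0' bp' _] pq' q0' _ [bq' _]]]] cc'.
rewrite -cc' in bq'.
have : agree k (blade q) (blade q').
  apply: agreeW (k_le_M P) (agree_trans (agree_sym (base_code_near bq)) _).
  exact: base_code_near bq'.
have := base_codeP p; rewrite bp => -[-> _]; have := base_codeP p'; rewrite bp' => -[-> _].
by move=> /stemP; rewrite (edge_stem pq q0) (edge_stem pq' q0').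
Qed.

(** Both image heights are within [r0] of [H D i] and off the windows of radius [2 * r0], so no
    window centre lies between them. *)
Lemma code_attracting_fibre D D1 D2 (i i1 i2 : 'I_N.+1) :
  code_edge (Some (Some D, Some (i, true))) (Some (Some D1, Some (i1, true))) ->
  code_edge (Some (Some D, Some (i, true))) (Some (Some D2, Some (i2, true))) -> i1 = i2.
Proof.
move=> /code_edge_base[p [q [/codeP[p0 bp fp] pq q0 _ [_ fq]]]].
move=> /code_edge_base[p' [q' [/codeP[p0' bp' fp'] pq' q0' _ [_ fq']]]].
have := edge_off_window pq q0 (r_off_window bp fp); rewrite fq => -[->].
have := edge_off_window pq' q0' (r_off_window bp' fp'); rewrite fq' => -[->].
congr inord; have r00 := r0_gt0.
apply: (@gap_close _ _ _ (2 * r0)) (attracting_off_window bp fp) (attracting_off_window bp' fp') _.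
  by lra.
have iN : (i <= N)%N by rewrite -ltnS.
have := fibre_codeP p; rewrite fp => /(fibre_image P iN (base_code_near bp)).
have := fibre_codeP p'; rewrite fp' => /(fibre_image P iN (base_code_near bp')).
have := ler_distD (H D i) (height (f p)) (height (f p')).
by rewrite (distrC (H D i) (height _)); lra.
Qed.

Lemma repelling_near p q D j : base_code p = Some D -> base_code q = Some D ->
  rho < height p -> rho < height q ->
  fibre_code p = Some (j, false) -> fibre_code q = Some (j, false) ->
  d p q <= e /\ `|height p - height q| <= rho.
Proof.
move=> bp bq p0 q0 fp fq; have rho0 := rho_gt0 P.
apply: (repelling_small P); [|exact: lt_trans p0|exact: lt_trans q0|].
  exact: agree_trans (agree_sym (base_code_near bp)) (base_code_near bq).
have := fibre_codeP p; rewrite fp => -[_ pj _].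
have := fibre_codeP q; rewrite fq => -[_ qj _].
have := ler_distD (b j) (height (f p)) (height (f q)).
by rewrite (distrC (b j) (height _)); lra.
Qed.

(** The target cell has height diameter at most [rho], while points coming through different windows
    are separated by a level with margin [rho] on each side. *)
Lemma code_repelling_fibre D D1 D2 (i i1 i2 : 'I_N.+1) :
  code_edge (Some (Some D1, Some (i1, false))) (Some (Some D, Some (i, false))) ->
  code_edge (Some (Some D2, Some (i2, false))) (Some (Some D, Some (i, false))) -> i1 = i2.
Proof.
move=> /code_edge_base[p [q [/codeP[p0 bp fp] pq q0 _ [bq fq]]]].
move=> /code_edge_base[p' [q' [/codeP[p0' bp' fp'] pq' q0' _ [bq' fq']]]].
have [_] := repelling_near bq bq' q0 q0' fq fq'.
have := fibre_codeP p; rewrite fp => -[i1N p1 _].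
have := fibre_codeP p'; rewrite fp' => -[i2N p2 _].
have := fibre_codeP q; rewrite fq => -[_ _ farq].
have := fibre_codeP q'; rewrite fq' => -[_ _ farq'].
have := edge_repelling pq q0 i1N p1 farq.
have := edge_repelling pq' q0' i2N p2 farq'.
have rho0 := rho_gt0 P; rewrite ler_norml => h1 h2 h3; apply/val_inj => /=.
case: (ltngtP i1 i2) => // /le_mark h; exfalso; move: h h1 h2 h3 rho0; lra.
Qed.

Lemma code_return_unique : return_unique code_edge.
Proof.
apply: cell_return_unique.
- exact: code_edge_apex.
- by move=> u w /code_edge_level[].
- by move=> u w /code_edge_level[].
- exact: code_attracting_base.
- exact: code_repelling_base.
- exact: code_attracting_fibre.
- exact: code_repelling_fibre.
Qed.

(** * Size and separation of recurrent cells *)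

Lemma returning_code p w : returning code_edge (code p) w ->
  height p <= rho \/ exists D a, [/\ rho < height p, base_code p = Some D & fibre_code p = Some a].
Proof.
move=> pw; have [hp|hp] := leP (height p) rho; [by left|right].
have nt : ~ transient (code p).
  apply: returning_transient pw => u' w'; first by move=> /code_edge_level[].
  by move=> /code_edge_level[].
move: nt; rewrite (code_above hp).
case: (base_code p) => [D|]; last by case; left.
case: (fibre_code p) => [a|]; last by case; right.
by move=> _; exists D, a.
Qed.

Lemma code_small p q w : returning code_edge (code p) w -> code p = code q -> d p q <= e.
Proof.
move=> /returning_code[hp|[D [a [hp bp fp]]]].
  rewrite (code_apex hp); have [hq _|hq] := leP (height q) rho; first exact: (apex_small P).
  by rewrite (code_above hq); case: (base_code q).
rewrite (code_above hp) bp fp => /esym/codeP[hq bq fq].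
case: a fp fq => i [] fp fq; last by have [] := repelling_near bp bq hp hq fp fq.
apply: (box_small P).
  apply: agreeW (k_le_M P) (agree_trans (agree_sym (base_code_near bp)) _).
  exact: base_code_near bq.
have := fibre_codeP p; rewrite fp; have := fibre_codeP q; rewrite fq.
have := ler_distD (mark i) (height p) (height q); rewrite (distrC (mark i) (height _)).
by have := rho_lt P; have := rho_gt0 P; lra.
Qed.

(** An attracting cell above the apex has height more than [3 * rho]; for a repelling cell compare
    images, which lie above [3 * r0] for [q] and below [r0] for [p]. *)
Lemma apex_separated p q D a : height p <= rho -> rho < height q ->
  base_code q = Some D -> fibre_code q = Some a -> delta <= d p q.
Proof.
move=> hp hq bq fq; rewrite leNgt; apply/negP => pq.
have [dpq _] := delta_coord P pq; have fpq := delta_image P pq.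
have rho0 := rho_gt0 P; have rhoN := rho_lt P.
case: a fq => i [] fq; have := fibre_codeP q; rewrite fq.
  move=> qi; have i0 : (0 < i)%N.
    rewrite lt0n; apply/eqP => i0; move: qi.
    by rewrite i0 mark0 subr0 ger0_norm ?height_ge0// leNgt hq.
  have := mark_gap i0; rewrite mark0; move: dpq qi; rewrite ltr_norml ler_norml; lra.
move=> [iN qi _]; have := apex_image P hp; have [wi _] := window_in P iN.
have := mark_ge0 i; have := r_le_r0 P; have := r0_gt0.
move: fpq qi; rewrite ltr_norml ler_norml; move: wi; lra.
Qed.

(** Points this close and this high share [k + m] bits, which decide whether the cell is attracting
    and, through [blade_map_close], which repelling cell it can be. *)
Lemma base_code_close p q D D' : rho < height p -> rho < height q -> d p q < delta ->
  base_code p = Some D -> base_code q = Some D' -> D = D'.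
Proof.
move=> hp hq pq bp bq; have rho0 := rho_gt0 P.
have ag : agree (k + m) (blade p) (blade q).
  by have [_] := delta_coord P pq; apply; lra.
have agk := agreeW (leq_addr m k) ag.
have at_eq p1 q1 : agree (k + m) (blade p1) (blade q1) ->
    agree (k + m) (attractor k (blade p1)) (blade p1) ->
    base_code q1 = Some (stem k (blade q1), true).
  move=> xy hx; apply: base_code_attracting.
  by rewrite -(attractor_stem (agreeW (leq_addr m k) xy)); exact: agree_trans hx xy.
have cp := base_codeP p; have cq := base_codeP q; rewrite bp in cp; rewrite bq in cq.
have pk : stem k (blade p) = stem k (blade q) by apply/stemP.
case: D D' bp bq cp cq => [w []] [w' []] bp bq [-> hp'] [-> hq'].
- by rewrite pk.
- by have := at_eq p q ag hp'; rewrite bq.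
- by have := at_eq q p (agree_sym ag) hq'; rewrite bp.
- congr (_, _); apply/stemP/(blade_map_close P); exact: agreeW (M_le_km P) ag.
Qed.

(** Different levels and different windows are far apart. In the mixed case one image is more than
    [2 * r0] from the window centre and the other within [r <= r0], yet the images are less than
    [r0] apart. *)
Lemma fibre_code_close p q D a a' : d p q < delta ->
  base_code p = Some D -> base_code q = Some D ->
  fibre_code p = Some a -> fibre_code q = Some a' -> a = a'.
Proof.
move=> pq bp bq fp fq; have [dpq _] := delta_coord P pq; have fpq := delta_image P pq.
have cp := fibre_codeP p; have cq := fibre_codeP q; rewrite fp in cp; rewrite fq in cq.
have rho0 := rho_gt0 P; have rhoN := rho_lt P; have r00 := r0_gt0; have rr0 := r_le_r0 P.
case: a a' fp fq cp cq => [i []] [j []] fp fq.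
- move=> pi qj; congr (_, _); apply/val_inj => /=; apply: (mark_unique pi).
  by move: dpq qj; rewrite ltr_norml !ler_norml; lra.
- move=> _ [jN qj _]; have off := attracting_off_window bp fp jN.
  by exfalso; move: off fpq qj; rewrite ltr_norml ler_norml ltr_normr; lra.
- move=> [iN pi _] _; have off := attracting_off_window bq fq iN.
  by exfalso; move: off fpq pi; rewrite ltr_norml ler_norml ltr_normr; lra.
- move=> [iN pi _] [jN qj _]; congr (_, _); apply/val_inj => /=.
  have [wi wi'] := window_in P iN; have [wj wj'] := window_in P jN.
  move: fpq pi qj; rewrite ltr_norml !ler_norml => h1 h2 h3.
  by case: (ltngtP i j) => // /le_mark h; exfalso; move: h h1 h2 h3 wi wi' wj wj'; lra.
Qed.

Lemma code_separated p q u w : returning code_edge (code p) u ->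
  returning code_edge (code q) w -> code p <> code q -> delta <= d p q.
Proof.
move=> /returning_code[hp|[D [a [hp bp fp]]]] /returning_code[hq|[D' [a' [hq bq fq]]]].
- by rewrite (code_apex hp) (code_apex hq).
- by move=> _; exact: apex_separated hp hq bq fq.
- by move=> _; rewrite (cmetric_sym dC); exact: apex_separated hq hp bp fp.
rewrite (code_above hp) (code_above hq) bp bq fp fq leNgt => nc; apply/negP => pq.
have DD' := base_code_close hp hq pq bp bq; rewrite -DD' in bq nc.
by apply: nc; rewrite (fibre_code_close pq bp bq fp fq).
Qed.

Lemma perturbation_coded : coded d perturbation e.
Proof.
have ex_block p : exists j : 'I_N.+1, mark j <= height p <= mark j + N%:R^-1.
  have [j jN] := find_block (N_gt0 P) (height_itv p).
  rewrite -/(mark j) -/(mark j.+1) markS => hj.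
  by exists (inord j); rewrite inordK// ltnS ltnW.
have [blk blkP] := choice ex_block.
(* Transient cells can be large; the labels cut them into boxes given by a stem and one block of
   heights. *)
apply: (@coding_refine _ _ _ _ _ delta _ _ code_edge code
  (fun p => (stem k (blade p), blk p)) (point, ord0)).
- exact: delta_gt0 P.
- exact: code_edge_self.
- exact: code_return_unique.
- exact: code_small.
- move=> p q pq; have /= /stemP pk := congr1 fst pq; have /= blkE := congr1 snd pq.
  apply: (box_small P) => //.
  by have := blkP p; have := blkP q; rewrite blkE ler_norml; lra.
- exact: code_separated.
Qed.

End coding.

(** * Choice of the parameters *)

Lemma stem_word k (w : k.-tuple bool) : stem k (word w) = w.
Proof. by apply: eq_from_tnth => i; rewrite tnth_mktuple /word (tnth_nth false). Qed.

(** General position in the base: each cylinder offers infinitely many tails with leading bit 1, and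
    only finitely many points are forbidden. *)
Lemma exists_repeller_tails k (F : k.-tuple bool -> cantor_space) :
  exists z : k.-tuple bool -> cantor_space, forall w, z w 0%N = true /\
    forall w', graft k (word w) (z w) <> F w'.
Proof.
pose tl (n : nat) : cantor_space := fun i => (i == 0%N) || (i == n.+1).
suff ex : forall w : k.-tuple bool, exists z : cantor_space, z 0%N = true /\
    forall w', graft k (word w) z <> F w' by have [h hP] := choice ex; exists h.
move=> w; have inj : injective (fun n => graft k (word w) (tl n)).
  move=> n n' /(congr1 (tail k)); rewrite !tail_graft.
  move=> /(congr1 (fun z : cantor_space => z n.+1)).
  by rewrite /tl /= eqxx eqSS => /esym/eqP.
by have [n nP] := avoid_finite F inj; exists (tl n).
Qed.

(** General position in the fibre: every block contains infinitely many candidates for a window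
    centre. *)
Lemma exists_windows (R : realType) (N : nat) (I : finType) (F : I -> R) : (0 < N)%N ->
  exists b : nat -> R, forall j, j%:R / N%:R < b j < j.+1%:R / N%:R /\
    forall i, b j <> F i.
Proof.
move=> N0; suff ex : forall j, exists b : R, j%:R / N%:R < b < j.+1%:R / N%:R /\
    forall i, b <> F i by have [h hP] := choice ex; exists h.
have h0 : 0 < N%:R^-1 :> R by rewrite invr_gt0 ltr0n.
move=> j; have inj : injective (fun n => j%:R / N%:R + N%:R^-1 * n.+2%:R^-1 : R).
  move=> n n' /addrI/(mulfI (lt0r_neq0 h0))/invr_inj/eqP.
  by rewrite eqr_nat => /eqP[].
have [n nP] := avoid_finite F inj; exists (j%:R / N%:R + N%:R^-1 * n.+2%:R^-1); split => //.
rewrite -[j.+1%:R]natr1 mulrDl mul1r ltrDl mulr_gt0//= ltrD2l.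
by rewrite gtr_pMr// invf_lt1// ltr1n.
Qed.

Lemma exists_disagreement (I : finType) (F G : I -> cantor_space) :
  (forall i, F i <> G i) -> exists n, forall i, ~ agree n (F i) (G i).
Proof.
move=> FG; have /choice[h hP] : forall i, exists n, ~ agree n (F i) (G i).
  move=> i; apply: contrapT => none; apply: (FG i); apply/funext => n.
  apply: contrapT => ne; apply: none; exists n.+1 => ag; apply: ne; exact: ag.
exists (\max_i h i) => i /(agreeW (leq_bigmax i)); exact: hP.
Qed.

Lemma nat_bound4 (a b c d : nat) : exists M, [/\ a <= M, b <= M, c <= M & d <= M]%N.
Proof. by exists (a + b + c + d)%N; split; lia. Qed.

Section parameters.
Variables (R : realType) (d : cantor_fan R -> cantor_fan R -> R).
Hypothesis dC : compatible_metric d.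
Variables f g : cantor_fan R -> cantor_fan R.
Hypotheses (fc : continuous f) (gc : continuous g) (fK : cancel f g) (gK : cancel g f).

(** Order of choice: [k] and [N] fix a grid of boxes of size [e]; [v] and then [b] are put in
    general position; [r0] measures the clearance of the windows; then come [rho], [r], [M] and [m];
    [l] and [delta] are chosen last. *)
Lemma exists_perturbation_data e : 0 < e -> exists N k m M v b r r0 l rho delta H,
  @perturbation_data R d f g N k m M v b r r0 l rho delta e H.
Proof.
move=> e0.
have [k kP] := fan_unif dC e0.
have [N N0 N_k] : exists2 N, (0 < N)%N & N%:R^-1 < k.+1%:R^-1 :> R.
  by exists k.+2 => //; rewrite ltf_pV2 ?posrE ?ltr0n// ltr_nat.
have [a2 a20 a2P] : exists2 a, 0 < a & forall p, height p < a -> d p (apex R) < e / 2.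
  by apply: apex_unif => //; rewrite divr_gt0.
have [z zP] := exists_repeller_tails (fun w : k.-tuple bool => blade_map f (word w)).
pose v x := z (stem k x).
have v_stem x y : agree k x y -> v x = v y by move=> /stemP; rewrite /v => ->.
have repE x : repeller k v x = repeller k v (word (stem k x)).
  rewrite /repeller (v_stem _ _ (agree_word_stem x)).
  by apply: graft_stem; apply/agree_sym/agree_word_stem.
pose bp (D : k.-tuple bool * bool) := base_pt g v D.
pose H D i := height (f (fan_pt (bp D) (i%:R / N%:R))).
have [b bP] := exists_windows (fun Di : k.-tuple bool * bool * 'I_N.+1 => H Di.1 Di.2) N0.
have avoid (Dij : k.-tuple bool * bool * 'I_N.+1 * 'I_N) :
    0 < `|H Dij.1.1 Dij.1.2 - b Dij.2|.
  case: Dij => [[D i] j] /=; rewrite normr_gt0 subr_eq0; apply/eqP => HE.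
  by have [_ /(_ (D, i))] := bP j; rewrite /= HE.
have inside (j : 'I_N) : 0 < Num.min (b j - j%:R / N%:R) (j.+1%:R / N%:R - b j).
  by have [/andP[b1 b2] _] := bP j; rewrite lt_min !subr_gt0 b1.
have [r1 r10 r1P] := finite_lower_bound avoid.
have [r2 r20 r2P] := finite_lower_bound inside.
pose r0 := Num.min r1 r2 / 8.
have r00 : 0 < r0 by rewrite divr_gt0// lt_min r10.
have r0r1 : 8 * r0 <= r1 by rewrite /r0 mulrC divfK// ge_min lexx.
have r0r2 : 8 * r0 <= r2 by rewrite /r0 mulrC divfK// ge_min lexx orbT.
have differ (ww : k.-tuple bool * k.-tuple bool) :
    repeller k v (word ww.1) <> blade_map f (word ww.2).
  by rewrite /repeller /v stem_word; have [_] := zP ww.1; apply.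
(* Repellers and images of attractors are finitely many distinct points, told apart by [m0] bits. *)
have [m0 m0P] := exists_disagreement differ.
have [M2 M2P] := blade_map_unif dC fc gc fK gK (maxn k m0).
have [e1 e10 e1P] := height_unif dC 0 r00.
have [e2 e20 e2P] := continuous_unif dC fc e10.
have [n2 n2P] := fan_pt_unif dC e20.
have [a5 a50 a5P] := homeo_height_small dC fc fK r00.
have n20 : 0 < n2.+1%:R^-1 :> R by [].
have N_inv0 : 0 < N%:R^-1 :> R by rewrite invr_gt0 ltr0n.
(* The four bounds serve the size of the apex cell, its image, the images of attracting cells and
   the spacing of levels. *)
pose rho := Num.min (Num.min a2 a5) (Num.min n2.+1%:R^-1 N%:R^-1) / 8.
have min0 : 0 < Num.min (Num.min a2 a5) (Num.min n2.+1%:R^-1 N%:R^-1) by rewrite !lt_min a20 a50 n20.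
have rho0 : 0 < rho by rewrite divr_gt0.
have rho8 : 8 * rho = Num.min (Num.min a2 a5) (Num.min n2.+1%:R^-1 N%:R^-1).
  by rewrite /rho mulrC divfK.
have [rho_a2 rho_a5 rho_n2 rho_N] :
    [/\ 8 * rho <= a2, 8 * rho <= a5, 8 * rho <= n2.+1%:R^-1 & 8 * rho <= N%:R^-1].
  by rewrite rho8 !ge_min !lexx !orbT.
have [e4 e40 e4P] := height_unif dC 0 rho0.
(* Repelling cells are small because their images are small: [g] brings [e5]-close points within [e]
   and, through [e4], to heights within [rho]. *)
have [|e5 e50 e5P] := @continuous_unif R d dC g (Num.min e e4) gc; first by rewrite lt_min e0.
have [n3 n3P] := fan_unif dC e50.
have [M4 M4P] := blade_map_unif dC fc gc fK gK n3.
pose r := Num.min r0 (n3.+1%:R^-1 / 4).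
have r_gt0 : 0 < r by rewrite lt_min r00 divr_gt0.
have r_n3 : 4 * r <= n3.+1%:R^-1.
  by rewrite mulrC -ler_pdivlMr// ge_min lexx orbT.
have [M [kM M2M n2M M4M]] := nat_bound4 k M2 n2 M4.
have [M5 M5P] := blade_map_unif dC gc fc gK fK M.
have [m [m_gt0 Mm M5m m0m]] := nat_bound4 1 M M5 m0.
have {}Mm : (M <= k + m)%N := leq_trans Mm (leq_addl _ _).
have {}M5m : (M5 <= k + m)%N := leq_trans M5m (leq_addl _ _).
have {}m0m : (m0 <= k + m)%N := leq_trans m0m (leq_addl _ _).
have rho4 : 0 < rho / 4 by rewrite divr_gt0.
have [d1 d10 d1P] := height_unif dC (k + m) rho4.
exists N, k, m, M, v, b, r, r0, (Num.min (rho / 4) (1 / 2)), rho, (Num.min d1 e2), H.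
split => //.
- by move=> x; have [] := zP (stem k x).
- by rewrite ge_min lexx.
- by rewrite lt_min rho4/= gt_min; apply/andP; split; [lra|apply/orP; right; lra].
- by rewrite ge_min lexx.
- by move: rho0 rho_N; lra.
- by rewrite lt_min d10.
- move=> j jN; have := r2P (Ordinal jN); rewrite le_min /= => /andP[].
  by move: r00 r0r2; split; lra.
- move=> x y xy; apply: (@agreeW _ (maxn k m0)); first exact: leq_maxl.
  by apply: M2P; exact: agreeW xy.
- by move=> x y xy; apply: M5P; exact: agreeW xy.
- move=> x; rewrite attractor_word repE => xa xr.
  (* If [x] is near its attractor and its image near a repeller, that repeller agrees with the image
     of the attractor to depth [m0]. *)
  apply: (m0P (stem k (blade_map f x), stem k x)) => /=.
  apply: (agree_trans (agreeW m0m xr)).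
  apply/agree_sym/(agreeW (leq_maxr k m0))/M2P; apply: agreeW xa.
  exact: leq_trans Mm.
- move=> p D i iN near hp; rewrite distrC.
  have : d (fan_pt (bp D) (i%:R / N%:R)) p < e2.
    rewrite -[p]fan_ptK; apply: n2P.
    + by rewrite divr_ge0//= ler_pdivrMr ?ltr0n// mul1r ler_nat.
    + exact: agreeW near.
    + by rewrite distrC; apply: le_lt_trans hp _; apply: lt_le_trans rho_n2; lra.
  by move=> /e2P/e1P[].
- move=> D i j iN jN; have := r1P (D, Ordinal (iN : (i < N.+1)%N), Ordinal jN) => /=.
  by apply: le_trans; apply: le_trans r0r1; lra.
- by move=> p hp; apply: a5P; apply: le_lt_trans hp _; apply: lt_le_trans rho_a5; lra.
- by move=> p q; rewrite lt_min => /andP[/d1P].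
- by move=> p q; rewrite lt_min => /andP[_ /e2P/e1P[]].
- move=> p q pq p0 q0 fpq.
  have : d p q < Num.min e e4.
    rewrite -(fK p) -(fK q); apply/e5P/n3P.
      rewrite !(blade_homeo dC fc fK)//; apply: M4P.
      exact: agreeW pq.
    by apply: le_lt_trans fpq _; apply: lt_le_trans r_n3; move: r_gt0; lra.
  by rewrite lt_min => /andP[/ltW pqe /e4P[/ltW]].
- by move=> p q pq hpq; apply/ltW/kP => //; exact: le_lt_trans hpq N_k.
- move=> p q hp hq; have small t : t <= rho -> t < a2.
    by move=> /le_lt_trans; apply; apply: lt_le_trans rho_a2; lra.
  have := cmetric_triangle dC (apex R) p q; rewrite (cmetric_sym dC (apex R) q).
  by have := a2P p (small _ hp); have := a2P q (small _ hq); lra.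
Qed.

End parameters.

Theorem theorem6p32 (R : realType) (d : cantor_fan R -> cantor_fan R -> R)
    (dC : compatible_metric d) :
  let HomeoC := homeo_space (@cantor_fan_compact R) dC in
  comeager [set phi : HomeoC | ~ exists x y, li_yorke_pair d phi x y] /\
  comeager [set phi : HomeoC | topological_entropy d phi = 0%E].
Proof.
apply: (dense_coded_generic (apex R)) => -[f fh] e a e0 a0.
have [fc [g [gc fK gK]]] := fh.
(* One scale governs both the size of the cells and the size of the perturbation. *)
have ea0 : 0 < Num.min e a by rewrite lt_min e0.
have [N [k [m [M [v [b [r [r0 [l [rho [delta [H P]]]]]]]]]]]] :=
  exists_perturbation_data dC fc gc fK gK ea0.
exists (Homeo (perturbation_homeo dC fc gc fK gK P)) => [|p].
  apply: coded_le (perturbation_coded dC fc gc fK gK P).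
  by rewrite ge_min lexx.
by rewrite (le_trans (perturbation_close P p))// ge_min lexx orbT.
Qed.
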